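(* For every $d\in\mathbb{N}$ (including $0$), the space $\mathrm{P}_d\mathrm{LV}(\mathbb{R}^n)$ is a Fréchet space with respect to the compact-to-bounded topology.
   Context: $\mathrm{Conv}(\mathbb{R}^n,\mathbb{R})$ is the space of all finite convex functions $f:\mathbb{R}^n\to\mathbb{R}$ with the topology of locally uniform convergence. $\mathcal{M}(\mathbb{R}^n)\cong C_c(\mathbb{R}^n)'$ is the space of complex Radon measures on $\mathbb{R}^n$ with the weak* topology. A map $\Psi:\mathrm{Conv}(\mathbb{R}^n,\mathbb{R})\to\mathcal{M}(\mathbb{R}^n)$ is a local functional if $f|_U=h|_U$ for some open $U\subset\mathbb{R}^n$ implies $\Psi(f)|_U=\Psi(h)|_U$. Let $\mathrm{A}(n,\mathbb{R})$ be the space of all affine functions $\ell:\mathbb{R}^n\to\mathbb{R}$. A local functional $\Psi$ is polynomial of degree at most $d$ if $\ell\mapsto\Psi(f+\ell)$ is a polynomial of degree at most $d$ on $\mathrm{A}(n,\mathbb{R})$ (with values in $\mathcal{M}(\mathbb{R}^n)$) for every $f$. $\mathrm{P}_d\mathrm{LV}(\mathbb{R}^n)$ is the space of all continuous local functionals that are polynomial of degree at most $d$. For $\phi\in C_c(\mathbb{R}^n)$ write $\Psi(f;\phi)=\int_{\mathbb{R}^n}\phi\,d[\Psi(f)]$. The compact-to-bounded topology on $\mathrm{P}_d\mathrm{LV}(\mathbb{R}^n)$ is the locally convex topology induced by the (finite) semi-norms $$\|\Psi\|_{A;K}:=\sup\{|\Psi(f;\phi)|: f\in K,\ \phi\in C_c(\mathbb{R}^n),\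 \mathrm{supp}\,\phi\subset A,\ \|\phi\|_\infty\le 1\}$$ for all compact $A\subset\mathbb{R}^n$ and all compact $K\subset\mathrm{Conv}(\mathbb{R}^n,\mathbb{R})$. *)

(* Defs.v *)
From HB Require Import structures.
From mathcomp Require Import all_boot all_order all_algebra.
From mathcomp Require Import complex.
From mathcomp Require Import all_classical all_reals all_analysis.

Set Implicit Arguments.
Unset Strict Implicit.
Unset Printing Implicit Defensive.

Import Order.TTheory GRing.Theory Num.Theory.
Import numFieldNormedType.Exports.
Import ComplexField.Normc.

Local Open Scope classical_set_scope.
Local Open Scope complex_scope.
Local Open Scope ring_scope.

(* A locally convex complex topological vector space whose topology is induced
   by a complete translation-invariant metric. The [nbhs] clause says that the
   given topology is the metric one, so Hausdorffness is included. *)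
Definition frechet_space (R : realType) (E : preTopologicalLmodType R[i]) :
    Prop :=
  [/\ continuous (fun z : E * E => z.1 + z.2),
      continuous (fun z : R[i]^o * E => z.1 *: z.2),
      (exists2 B : set_system E,
         (forall b, b \in B -> convex_set b) & basis B)
    & exists rho : E -> E -> R,
        [/\ [/\ forall x y, rho x y = 0 <-> x = y,
                forall x y, rho x y = rho y x
              & forall x y z, rho x z <= rho x y + rho y z],
            forall x y z, rho (x + z) (y + z) = rho x y,
            forall x, nbhs x =
              filter_from [set e : R | 0 < e] (fun e => [set y | rho x y < e])
          & forall u : nat -> E,
              (forall e : R, 0 < e -> exists N, forall i j,
                (N <= i)%N -> (N <= j)%N -> rho (u i) (u j) < e) ->
              exists l : E, u @ \oo --> l]].

Definition tsupport (R : realType) n (phi : 'rV[R]_n -> R[i]) : set 'rV[R]_n :=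
  closure [set x | phi x != 0].

Section Cc.
Context (R : realType) (n : nat).

Definition is_Cc : {pred 'rV[R]_n -> R[i]^o} :=
  mem [set phi : 'rV[R]_n -> R[i]^o |
    continuous phi /\ compact (tsupport phi)].

Record Cc := MkCc { Cc_fun :> 'rV[R]_n -> R[i]^o ; _ : Cc_fun \in is_Cc }.

HB.instance Definition _ := [isSub for Cc_fun].
HB.instance Definition _ := [Choice of Cc by <:].

Lemma Cc_submod_closed : submod_closed is_Cc.
Proof.
split.
  rewrite inE; split; first exact: (@cst_continuous _ R[i]^o 0).
  rewrite /tsupport (_ : [set x | _] = set0); last first.
    by apply/seteqP; split=> // x /=; rewrite eqxx.
  by rewrite closure0; exact: compact0.
move=> a f g; rewrite !inE => -[cf sf] [cg sg]; split.
  move=> x; have cfx : a \*: f @ x --> a *: f x.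
    exact: (@cvgZl_tmp _ R[i]^o _ (nbhs x) _ _ _ _ (cf x)).
  exact: (@cvgD _ R[i]^o _ (nbhs x) _ _ _ _ _ cfx (cg x)).
apply: (@subclosed_compact _ _ (tsupport f `|` tsupport g)).
- exact: closed_closure.
- exact: compactU.
rewrite /tsupport -closureU; apply: closureS => x /= h.
have [f0|f0] := eqVneq (f x) 0; last by left.
right; apply: contra_neq h => g0.
by rewrite /GRing.add /= /GRing.scale /= f0 g0 scaler0 addr0.
Qed.

HB.instance Definition _ :=
  GRing.isSubmodClosed.Build _ _ is_Cc Cc_submod_closed.
HB.instance Definition _ := [SubChoice_isSubLmodule of Cc by <:].

(* The real supremum is taken over a nonempty bounded set. *)
Definition supnorm (phi : Cc) : R := sup (range (fun x => normc (phi x))).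

End Cc.

Section radon.
Context (R : realType) (n : nat).
Local Notation Cc := (Cc R n).

(* A complex Radon measure on R^n is not a globally finite set function in
   general; it is taken as the functional phi |-> \int phi dmu, i.e. an element
   of the dual of C_c(R^n). Continuity for the inductive limit topology of the
   spaces of functions supported in a given compact set is a sup-norm bound on
   each of them. *)
Definition is_radon : {pred Cc -> R[i]^o} :=
  mem [set mu : Cc -> R[i]^o |
    linear mu /\
    forall A : set 'rV[R]_n, compact A -> exists c : R,
      forall phi : Cc, tsupport phi `<=` A ->
        normc (mu phi) <= c * supnorm phi].

Record radon := MkRadon { radon_fun :> Cc -> R[i]^o ; _ : radon_fun \in is_radon }.

HB.instance Definition _ := [isSub for radon_fun].
HB.instance Definition _ := [Choice of radon by <:].

Lemma radon_submod_closed : submod_closed is_radon.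
Proof.
split.
  rewrite inE; split; first by move=> a f g; rewrite /= scaler0 addr0.
  by move=> A _; exists 0 => phi _; rewrite mul0r normc0.
move=> a mu nu; rewrite !inE => -[lmu bmu] [lnu bnu]; split.
  move=> b f g /=.
  change (a *: mu (b *: f + g) + nu (b *: f + g) =
    b *: (a *: mu f + nu f) + (a *: mu g + nu g)).
  by rewrite lmu lnu !scalerDr !scalerA mulrC addrACA.
move=> A cA; have [c1 h1] := bmu A cA; have [c2 h2] := bnu A cA.
exists (normc a * c1 + c2) => phi sA.
apply: (le_trans (le_normcD _ _)).
rewrite mulrDl; apply: lerD; last exact: h2.
rewrite normcM -mulrA; apply: ler_wpM2l; last exact: h1.
by case: (a) => x y; exact: sqrtr_ge0.
Qed.

HB.instance Definition _ :=
  GRing.isSubmodClosed.Build _ _ is_radon radon_submod_closed.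
HB.instance Definition _ := [SubChoice_isSubLmodule of radon by <:].

(* The weak* topology: pointwise convergence on C_c(R^n). *)
HB.instance Definition _ := Topological.copy radon
  (initial_topology (radon_fun : radon -> {ptws Cc -> R[i]^o})).

(* Equality of the restrictions to U: test functions on U are identified with
   the elements of C_c(R^n) supported in U. *)
Definition radon_eq_on (U : set 'rV[R]_n) (mu nu : radon) : Prop :=
  forall phi : Cc, tsupport phi `<=` U -> mu phi = nu phi.

End radon.

Section conv.
Context (R : realType) (n : nat).

Definition is_Conv : {pred 'rV[R]_n -> R} :=
  mem [set f : 'rV[R]_n -> R | convex_function [set: 'rV[R]_n] f].

Record Conv := MkConv { Conv_fun :> 'rV[R]_n -> R ; _ : Conv_fun \in is_Conv }.

HB.instance Definition _ := [isSub for Conv_fun].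
HB.instance Definition _ := [Choice of Conv by <:].

(* Locally uniform convergence, i.e. uniform convergence on compact sets. *)
HB.instance Definition _ := Topological.copy Conv
  (initial_topology (Conv_fun : Conv -> {family compact, 'rV[R]_n -> R})).

(* Linear coordinates on A(n, R): constant term first, then the slope. *)
Definition affine (l : 'rV[R]_n.+1) (x : 'rV[R]_n) : R :=
  l 0 ord0 + \sum_(j < n) l 0 (lift ord0 j) * x 0 j.

Lemma add_affine_subproof (f : Conv) (l : 'rV[R]_n.+1) :
  (fun x => f x + affine l x) \in is_Conv.
Proof.
case: f => f fP; have := fP; rewrite !inE => cf t x y xT yT /=.
have := cf t x y xT yT; rewrite !convRE => h.
have -> : affine l (conv t x y) =
    t%:inum * affine l x + (1 - t%:inum) * affine l y.
  rewrite /affine !mulrDr [RHS]addrACA -mulrDl (addrC t%:inum) subrK mul1r.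
  congr (_ + _).
  rewrite !mulr_sumr -big_split /=; apply: eq_bigr => j _.
  by rewrite !mxE mulrDr !(mulrCA (l _ _)).
change (f (conv t x y) + (t%:inum * affine l x + (1 - t%:inum) * affine l y) <=
  t%:inum * (f x + affine l x) + (1 - t%:inum) * (f y + affine l y)).
by rewrite !mulrDr [leRHS]addrACA lerD2r.
Qed.

Definition add_affine (f : Conv) (l : 'rV[R]_n.+1) : Conv :=
  MkConv (add_affine_subproof f l).

End conv.

(* Polynomial maps of degree at most d on R^m with values in a complex vector
   space; [al] ranges over multi-indices, whose entries are automatically
   at most d. *)
Definition polynomial_map (R : realType) (m d : nat) (V : lmodType R[i])
    (F : 'rV[R]_m -> V) : Prop :=
  exists c : {ffun 'I_m -> 'I_d.+1} -> V, forall l : 'rV[R]_m,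
    F l = \sum_(al : {ffun 'I_m -> 'I_d.+1} | (\sum_i al i <= d)%N)
            (\prod_i l 0 i ^+ al i)%:C *: c al.

Section PdLV.
Context (R : realType) (n d : nat).
Local Notation Conv := (Conv R n).
Local Notation radon := (radon R n).

Definition local_functional (Psi : Conv -> radon) : Prop :=
  forall (U : set 'rV[R]_n) (f h : Conv), open U ->
    (forall x, U x -> f x = h x) -> radon_eq_on U (Psi f) (Psi h).

Definition polynomial_functional (Psi : Conv -> radon) : Prop :=
  forall f : Conv, polynomial_map d (fun l => Psi (add_affine f l)).

Definition is_PdLV : {pred Conv -> radon} :=
  mem [set Psi : Conv -> radon |
    [/\ continuous Psi, local_functional Psi & polynomial_functional Psi]].

Record PdLV := MkPdLV { PdLV_fun :> Conv -> radon ; _ : PdLV_fun \in is_PdLV }.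

HB.instance Definition _ := [isSub for PdLV_fun].
HB.instance Definition _ := [Choice of PdLV by <:].

Lemma continuous_radonP (Psi : Conv -> radon) :
  continuous Psi <->
  forall phi, continuous (fun f => Psi f phi : R[i]^o).
Proof.
split=> [cPsi phi f|h].
  have crf : continuous (@radon_fun R n : radon -> {ptws Cc R n -> R[i]^o}).
    exact: initial_continuous.
  have cpr := @proj_continuous (Cc R n) (fun=> R[i]^o) phi.
  exact: continuous_comp (continuous_comp (cPsi f) (crf (Psi f))) (cpr _).
apply: continuous_comp_initial => f.
have FF : Filter ((@radon_fun R n \o Psi) @ f).
  by apply: fmap_filter; exact: nbhs_filter.
apply/cvg_sup => phi.
pose g : Conv -> initial_topology
    (fun mu : {ptws Cc R n -> R[i]^o} => mu phi) := fun f => radon_fun (Psi f).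
have cg : continuous g by apply: continuous_comp_initial; exact: h.
exact: cg.
Qed.

Lemma PdLV_submod_closed : submod_closed is_PdLV.
Proof.
split.
  rewrite inE; split.
  - by apply/continuous_radonP => phi; exact: (@cst_continuous _ R[i]^o 0).
  - by [].
  - move=> f; exists (fun=> 0) => l.
    by rewrite big1 // => al _; rewrite scaler0.
move=> a Psi Phi; rewrite !inE => -[c1 l1 p1] [c2 l2 p2]; split.
- apply/continuous_radonP => phi f.
  move/continuous_radonP: c1 => /(_ phi f) c1.
  move/continuous_radonP: c2 => /(_ phi f) c2.
  pose F f := Psi f phi : R[i]^o.
  have c1' : a \*: F @ f --> a *: F f.
    exact: (@cvgZl_tmp _ R[i]^o _ (nbhs f) _ _ _ _ c1).
  exact: (@cvgD _ R[i]^o _ (nbhs f) _ _ _ _ _ c1' c2).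
- move=> U f h oU fh phi sphi.
  change (a *: (Psi f phi : R[i]^o) + Phi f phi =
    a *: (Psi h phi : R[i]^o) + Phi h phi).
  by rewrite (l1 U f h oU fh phi sphi) (l2 U f h oU fh phi sphi).
- move=> f; have [k1 h1] := p1 f; have [k2 h2] := p2 f.
  exists (a *: k1 + k2) => l.
  change (a *: Psi (add_affine f l) + Phi (add_affine f l) =
    \sum_(al : {ffun 'I_n.+1 -> 'I_d.+1} | (\sum_i al i <= d)%N)
      (\prod_i l 0 i ^+ al i)%:C *: (a *: k1 al + k2 al)).
  rewrite h1 h2 scaler_sumr -big_split /=; apply: eq_bigr => al _.
  by rewrite scalerDr !scalerA mulrC.
Qed.

HB.instance Definition _ :=
  GRing.isSubmodClosed.Build _ _ is_PdLV PdLV_submod_closed.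
HB.instance Definition _ := [SubChoice_isSubLmodule of PdLV by <:].

(* Valued in [\bar R], so that no finiteness is presupposed; the maximum with 0
   matters only for empty K. *)
Definition ctb_seminorm (A : set 'rV[R]_n) (K : set Conv) (Psi : PdLV) : \bar R :=
  maxe 0%E (ereal_sup [set z | exists (f : Conv) (phi : Cc R n),
    [/\ K f, tsupport phi `<=` A, supnorm phi <= 1
      & z = (normc (Psi f phi))%:E]]).

Definition ctb_subbase : set (set PdLV) :=
  [set B | exists A K (Psi0 : PdLV) (e : R),
    [/\ compact A, compact K, 0 < e
      & B = [set Psi | (ctb_seminorm A K (Psi - Psi0)%R < e%:E)%E]]].

(* The topology induced by the seminorms, generated by their open balls around
   all points. *)
HB.instance Definition _ := @isSubBaseTopological.Build PdLV _ ctb_subbase id.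

End PdLV.

(* Main.v *)
(* By the uniform boundedness principle on the continuous functions supported in
   a compact set, all seminorms are finite. If a convex f is bounded by M on a
   ball of radius r + 2, its infimal convolution with the cone 2M|x| is convex,
   2M-Lipschitz, and equal to f on the ball of radius r + 1. By locality the
   measures of the two functions agree on test functions supported in the ball
   of radius r. Hence every seminorm, and the evaluation at every function near a
   given one, is dominated by some knorm j, the seminorm of the ball of radius j
   and the compact set of j-Lipschitz convex f with |f 0| <= j. The topology is
   therefore given by an increasing sequence of norms. A Cauchy sequence
   converges uniformly on a neighbourhood of each convex function, so that its
   pointwise limit is continuous; the limit is polynomial because the
   coefficients are fixed linear combinations of values on a finite grid. *)

Require Import Defs.
From mathcomp Require Import all_boot all_order all_algebra complex.
From mathcomp Require Import finmap.
From mathcomp Require Import all_classical all_reals all_analysis.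
From mathcomp Require Import ring lra.

Set Implicit Arguments.
Unset Strict Implicit.
Unset Printing Implicit Defensive.

Import Order.TTheory GRing.Theory Num.Theory.
Import numFieldNormedType.Exports.
Import ComplexField.Normc.

Local Open Scope classical_set_scope.
Local Open Scope complex_scope.
Local Open Scope ring_scope.

(** * Complex numbers *)

Section complex_norm.
Context (R : realType).
Implicit Types z w : R[i].

(** The norm of [R[i]] takes its values in [R[i]]; this conversion lets every estimate below be made
    in [R]. *)
Lemma normr_normc z : `|z| = (normc z)%:C.
Proof. by case: z => a b; rewrite normc_def. Qed.

Lemma normc_ge0 z : 0 <= normc z.
Proof. by case: z => a b; exact: sqrtr_ge0. Qed.

Lemma normc_real (r : R) : normc r%:C = `|r|.
Proof. by rewrite /normc /= expr0n/= addr0 sqrtr_sqr. Qed.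

Lemma normcBC z w : normc (z - w) = normc (w - z).
Proof. by rewrite -normcN opprB. Qed.

Lemma complex_gt0P (e : R[i]) : 0 < e -> exists2 r : R, 0 < r & e = r%:C.
Proof.
case: e => a b; rewrite ltcE /= => /andP[/eqP b0 a0].
by exists a => //; rewrite b0.
Qed.

Lemma cvg_normcP (T : Type) (F : set_system T) (f : T -> R[i]^o) (z : R[i]^o) :
  Filter F ->
  f @ F --> z <-> forall e : R, 0 < e -> \forall t \near F, normc (z - f t) < e.
Proof.
move=> FF; split=> [/cvgrPdist_lt h e e0|h].
  have := h e%:C; rewrite ltcR => /(_ e0).
  by apply: filterS => t /=; rewrite normr_normc ltcR.
apply/cvgrPdist_lt => _ /complex_gt0P[r r0 ->].
by apply: filterS (h r r0) => t /= ?; rewrite normr_normc ltcR.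
Qed.

Lemma nbhs_normcP z (U : set R[i]^o) :
  nbhs (z : R[i]^o) U <->
  exists2 e : R, 0 < e & forall w, normc (z - w) < e -> U w.
Proof.
split=> [/nbhs_ballP[_ /complex_gt0P[r r0 ->] h]|[r r0 h]].
  by exists r => // w wr; apply: h; rewrite -ball_normE /ball_/= normr_normc ltcR.
apply/nbhs_ballP; exists r%:C; first by rewrite /= ltcR.
by move=> w; rewrite -ball_normE /ball_/= normr_normc ltcR => /h.
Qed.

(** Completeness is inherited from [R]: real and imaginary parts are 1-Lipschitz for [normc], so
    both are Cauchy. *)
Lemma normc_cauchy_cvg (u : nat -> R[i]) :
  (forall e : R, 0 < e -> exists N, forall i j,
    (N <= i)%N -> (N <= j)%N -> normc (u i - u j) < e) ->
  exists l : R[i]^o, (u : nat -> R[i]^o) @ \oo --> l.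
Proof.
move=> cu.
have part (p : R[i] -> R) : (forall z w, `|p z - p w| <= normc (z - w)) ->
    cvgn (p \o u).
  move=> hp; apply: cauchy_cvg; apply/cauchy_exP => e e0.
  have [N hN] := cu e e0.
  exists (p (u N)); exists N => // i /= Ni.
  by rewrite /= -ball_normE /ball_ /=; apply: le_lt_trans (hp _ _) _; exact: hN.
have leRe z : `|complex.Re z| <= normc z.
  case: z => a b /=; rewrite -sqrtr_sqr ler_sqrt ?lerDl ?sqr_ge0//.
  by rewrite addr_ge0 ?sqr_ge0.
have leIm z : `|complex.Im z| <= normc z.
  case: z => a b /=; rewrite -sqrtr_sqr ler_sqrt ?lerDr ?sqr_ge0//.
  by rewrite addr_ge0 ?sqr_ge0.
have reB z w : `|complex.Re z - complex.Re w| <= normc (z - w).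
  by apply: le_trans (leRe _); case: z w => a b [c d].
have imB z w : `|complex.Im z - complex.Im w| <= normc (z - w).
  by apply: le_trans (leIm _); case: z w => a b [c d].
have /cvg_ex[/= a ha] := part _ reB; have /cvg_ex[/= b hb] := part _ imB.
exists (a +i* b); apply/cvg_normcP => e e0.
have e2 : 0 < e / 2 by rewrite divr_gt0.
move/cvgrPdist_lt : ha => /(_ _ e2) ha; move/cvgrPdist_lt : hb => /(_ _ e2) hb.
near=> i.
have -> : ((a +i* b) : R[i]) - u i =
    (a - complex.Re (u i))%:C + (0 +i* (b - complex.Im (u i))).
  by case: (u i) => c d /=; simpc.
apply: le_lt_trans (le_normcD _ _) _.
rewrite (splitr e) ltrD// ?normc_real; first by near: i.
by rewrite /normc /= expr0n add0r sqrtr_sqr; near: i.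
Unshelve. all: by end_near. Qed.

End complex_norm.

(** * Convex functions *)

Section conv_topology.
Context (R : realType) (n : nat).
Local Notation V := 'rV[R]_n.
Implicit Types (f g : Conv R n) (C : set V).

Lemma convP f (t : R) (x y : V) : 0 <= t <= 1 ->
  f (t *: x + (1 - t) *: y) <= t * f x + (1 - t) * f y.
Proof.
move=> /andP[t0 t1]; case: f => f fP /=; have := fP; rewrite inE => cf.
have := cf (Itv01 t0 t1) x y (mem_set I) (mem_set I).
by rewrite convRE /=.
Qed.

Lemma is_ConvP (f : V -> R) :
  (forall (t : R) x y, 0 <= t <= 1 ->
    f (t *: x + (1 - t) *: y) <= t * f x + (1 - t) * f y) ->
  f \in @is_Conv R n.
Proof.
move=> h; rewrite inE => t x y _ _; rewrite convRE.
by apply: h; rewrite ge0 le1.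
Qed.

Lemma nbhs_Conv f C (e : R) : compact C -> 0 < e ->
  nbhs f [set g : Conv R n | forall x, C x -> `|f x - g x| < e].
Proof.
move=> cC e0.
have cf := @initial_continuous _ _
  (@Conv_fun R n : _ -> {family compact, V -> R}) f.
have := cf _ (@fam_nbhs V R compact C [set xy | ball xy.1 e xy.2]
  (f : {family compact, V -> R}) (entourage_ball _ (PosNum e0)) cC).
by apply: (@filterS (Conv R n) (nbhs f) (nbhs_filter f)) => g h x /h.
Qed.

Lemma cvg_Conv (F : set_system (Conv R n)) f : Filter F ->
  (forall C (e : R), compact C -> 0 < e ->
    F [set g : Conv R n | forall x, C x -> `|f x - g x| < e]) ->
  F --> f.
Proof.
move=> FF h.
have : (@Conv_fun R n @ F : set_system {family compact, V -> R}) -->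
    (Conv_fun f : {family compact, V -> R}).
  apply: (proj2 (@fam_cvgP V R compact ((@Conv_fun R n) @ F) f _)) => C cC U.
  move=> /uniform_nbhs[E [entE EU]].
  have [e /= e0 he] : exists2 e : R, 0 < e &
      [set xy : R * R | ball xy.1 e xy.2] `<=` E.
    by move: entE; rewrite -entourage_ballE => -[e e0 he]; exists e.
  apply: filterS (h C e cC e0) => g hg; apply: EU => /= x Cx.
  exact/he/hg.
move=> cF U [B [[W oW <-] Wf BU]].
by apply: filterS BU _; apply: cF; exact: open_nbhs_nbhs.
Qed.

Lemma conv_midpoint f (x y : V) :
  f (2^-1 *: x + 2^-1 *: y) <= 2^-1 * f x + 2^-1 * f y.
Proof.
have := @convP f 2^-1 x y; have -> : 1 - 2^-1 = 2^-1 :> R by field.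
by apply; lra.
Qed.

(** Induction on the coordinates used: the point is the midpoint of twice its first component and
    twice the rest, which is why the induction hypothesis is taken at [2 * r]. On the axis,
    convexity bounds [f] by its values at two fixed endpoints. *)
Lemma conv_bounded_above_coord f (s : seq 'I_n) (r : R) :
  exists M : R, forall x : V, `|x| <= r ->
    f (\sum_(i <- s) x 0 i *: delta_mx 0 i) <= M.
Proof.
elim: s r => [|i s ih] r; first by exists (f 0) => x _; rewrite big_nil.
have [M hM] := ih (2 * r).
(* The summand 1 keeps [a] positive, whatever the sign of [r]; the segment from [- a] to [a] then
   contains [2 * x 0 i], with barycentric coordinate [t] below. *)
pose a := `|2 * r| + 1.
have a0 : 0 < a by rewrite ltr_wpDl.
pose v : V := delta_mx 0 i.
exists (2^-1 * (`|f (a *: v)| + `|f ((- a) *: v)|) + 2^-1 * M) => x xr.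
rewrite big_cons.
have -> : x 0 i *: delta_mx 0 i + \sum_(j <- s) x 0 j *: delta_mx 0 j =
    2^-1 *: ((2 * x 0 i) *: v) +
    2^-1 *: (\sum_(j <- s) (2 *: x) 0 j *: delta_mx 0 j).
  rewrite scalerA mulKf// scaler_sumr; congr (_ + _).
  by apply: eq_bigr => j _; rewrite mxE scalerA mulKf.
apply: le_trans (conv_midpoint _ _ _) _.
apply: lerD; apply: ler_wpM2l => //; last first.
  by apply: hM; rewrite normrZ ger0_norm// ler_pM2l.
have xi : `|x 0 i| <= r.
  apply: le_trans xr; rewrite [leRHS]/Num.norm/= mx_normrE.
  exact: (le_bigmax _ (fun ij : 'I_1 * 'I_n => `|x ij.1 ij.2|) (0, i)).
pose t := (2 * x 0 i + a) / (2 * a).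
have ta : 2 * x 0 i + a = t * (2 * a) by rewrite /t mulfVK// mulf_neq0 ?gt_eqF.
have /andP[t0 t1] : 0 <= t <= 1.
  have := xi; rewrite ler_norml => /andP[x1 x2].
  have ra : 2 * r < a by rewrite /a (le_lt_trans (ler_norm _))// ltrDl.
  by rewrite /t ler_pdivrMr ?ler_pdivlMr ?mulr_gt0// mul0r mul1r; lra.
have -> : (2 * x 0 i) *: v = t *: (a *: v) + (1 - t) *: ((- a) *: v).
  by rewrite !scalerA -scalerDl; congr (_ *: _); lra.
apply: le_trans (convP _ _ _ _) _; first by rewrite t0.
apply: lerD; apply: le_trans (ler_norm _) _; rewrite normrM.
  by rewrite ger0_norm// ler_piMl.
by rewrite ger0_norm ?subr_ge0// ler_piMl// lerBlDr lerDl.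
Qed.

(** An upper bound on a symmetric ball yields a lower one, since midpoint convexity at 0 gives
    [2 * f 0 <= f x + f (- x)]. *)
Lemma conv_bounded f (r : R) : exists M : R, forall x : V, `|x| <= r ->
  `|f x| <= M.
Proof.
have [M hM] := conv_bounded_above_coord f (index_enum 'I_n) r.
have {}hM x : `|x| <= r -> f x <= M by move=> /hM; rewrite -row_sum_delta.
exists (`|M| + 2 * `|f 0|) => x xr; rewrite ler_norml.
have fx := hM _ xr; have fNx := hM (- x); rewrite normrN in fNx.
have {}fNx := fNx xr.
have := conv_midpoint f x (- x); rewrite scalerN subrr => h.
have := ler_norm M; have := ler_norm (f 0); have := ler_norm (- f 0).
by rewrite normrN => *; apply/andP; split; lra.
Qed.

Definition cball (r : R) : set V := [set x | `|x| <= r].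

Lemma compact_cball (r : R) : compact (cball r).
Proof.
apply: bounded_closed_compact.
  exists r; split; first exact: num_real.
  by move=> M rM x /= /le_trans; apply; exact: ltW.
by apply: (@closed_comp _ _ (@Num.norm R V) [set s | s <= r]);
  [move=> x _; exact: norm_continuous|exact: closed_le].
Qed.

Lemma compact_Conv_bounded (K : set (Conv R n)) (r : R) : compact K ->
  exists M : R, forall f, K f -> forall x : V, `|x| <= r -> `|f x| <= M.
Proof.
move=> /compact_near_coveringP cK.
(* Near-covering compactness, with candidate bounds tending to infinity, turns local bounds into a
   single one. *)
have := @cK _ (pinfty_nbhs R)
  (fun M f => forall x : V, `|x| <= r -> `|f x| <= M) _.
case=> [f _|M [_ hM]].
  have [M hM] := conv_bounded f r.
  have B1 : nbhs f [set g : Conv R n | forall x, `|x| <= r -> `|f x - g x| < 1].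
    exact: (@nbhs_Conv f _ 1 (@compact_cball r) ltr01).
  exists ([set g : Conv R n | forall x, `|x| <= r -> `|f x - g x| < 1],
    [set M' | M + 1 <= M']).
    by split => //=; apply: nbhs_pinfty_ge; exact: num_real.
  move=> [g M'] /= [hg hM'] x xr.
  apply: le_trans hM'; rewrite -[g x](subrK (f x)) addrC.
  by apply: le_trans (ler_normD _ _) _; rewrite lerD ?hM// distrC ltW ?hg.
exists (M + 1) => f Kf; apply: (hM (M + 1)) => //.
by rewrite ltrDl.
Qed.

(** The one-sided inequality is the Lipschitz condition, as [x] and [y] can be exchanged; the bound
    at 0 prevents escape by additive constants. *)
Definition lipschitz_Conv (L : R) : set (Conv R n) :=
  [set f | `|f 0| <= L /\ forall x y, f x - f y <= L * `|x - y|].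

(** Arzelà-Ascoli with ultrafilters: values at each point stay in a segment, so an ultrafilter
    converges pointwise; convexity and the bounds pass to the limit; the common Lipschitz constant
    makes the convergence uniform on compact sets. *)
Lemma compact_lipschitz_Conv (L : R) : compact (lipschitz_Conv L).
Proof.
rewrite compact_ultra => F UF FK.
have cvx x : exists l : R, (fun f : Conv R n => f x) @ F --> l.
  pose Fx := (fun f : Conv R n => f x) @ F.
  have [l [_ hl]] : `[- (L + L * `|x|), L + L * `|x|]%classic `&` cluster Fx !=set0.
    apply: segment_compact.
    apply: (@filterS _ F _ _ _ _ FK) => f [f0 fl] /=; rewrite in_itv/= -ler_norml.
    rewrite -(subrK (f 0) (f x)) addrC (le_trans (ler_normD _ _))// lerD//.
    rewrite ler_norml; have := fl x 0; have := fl 0 x.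
    by rewrite sub0r subr0 normrN => *; apply/andP; split; lra.
  (* For an ultrafilter a cluster point is a limit: otherwise the preimage of the complement of [B]
     would belong to [F]. *)
  exists l => B nB.
  have [//|FnB] := in_ultra_setVsetC ((fun f : Conv R n => f x) @^-1` B) UF.
  by have [z []] := hl (~` B) B FnB nB.
have [g hg] := choice cvx.
have PF : ProperFilter F := @ultra_proper _ _ UF.
have gl x y : g x - g y <= L * `|x - y|.
  apply: (ler_cvg_to (cvgB (hg x) (hg y)) (cvg_cst (L * `|x - y|))).
  by apply: filterS FK => f [_]; apply.
have cg : g \in @is_Conv R n.
  apply: is_ConvP => t x y t01.
  apply: (ler_cvg_to (hg (t *: x + (1 - t) *: y))
    (cvgD (cvgM (cvg_cst t) (hg x)) (cvgM (cvg_cst (1 - t)) (hg y)))).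
  by apply: nearW => f; exact: convP.
pose G := MkConv cg.
have g0 : `|g 0| <= L.
  apply: (ler_cvg_to (cvg_norm (hg 0)) (cvg_cst L)).
  by apply: filterS FK => f [].
have L0 : 0 <= L by apply: le_trans g0.
exists G; split; first by split.
apply: cvg_Conv => C e /compact_near_coveringP cC e0.
pose P (f : Conv R n) x' := `|G x' - f x'| < e.
have /cC : forall x, C x -> \forall x' \near x & f \near F, P f x'.
  move=> x Cx.
  (* Moving by less than [d] changes an [L]-Lipschitz function by less than [e / 3]; [L + 1] avoids
     dividing by 0. *)
  pose d := e / 3 / (L + 1).
  have L1 : 0 < L + 1 by rewrite ltr_wpDl.
  have d0 : 0 < d by rewrite !divr_gt0.
  have e3 : 0 < e / 3 by rewrite divr_gt0.
  move: (hg x) => /cvgrPdist_lt/(_ _ e3) hx.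
  exists ([set x' | `|x - x'| < d], 
    [set f : Conv R n | `|g x - f x| < e / 3] `&` lipschitz_Conv L).
    split => /=; last exact: filterI.
    by apply/nbhs_ballP; exists d => //= z; rewrite -ball_normE.
  move=> [x' f] /= [xx' [fx [_ fl]]].
  have Ld : L * `|x - x'| < e / 3.
    apply: (@le_lt_trans _ _ (L * d)); first by rewrite ler_wpM2l// ltW.
    have -> : e / 3 = (L + 1) * d by rewrite /d mulrCA divff ?mulr1// gt_eqF.
    by rewrite ltr_pM2r// ltrDl.
  move: fx; rewrite /P /= !ltr_norml => /andP[h1 h2].
  have := gl x x'; have := gl x' x; have := fl x x'; have := fl x' x.
  by rewrite (distrC x' x) => *; apply/andP; split; lra.
by apply: filterS => f.
Qed.

End conv_topology.

(** * Lipschitz regularization by infimal convolution with a cone *)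

Section lipschitz_regularization.
Context (R : realType) (n : nat).
Local Notation V := 'rV[R]_n.
Variables (f : Conv R n) (r M : R).
Hypotheses (r0 : 0 <= r) (fM : forall x : V, `|x| <= r + 1 -> `|f x| <= M).
Let L := 2 * M.

Let M0 : 0 <= M.
Proof. by apply: le_trans (fM (x := 0) _); rewrite ?normr0 ?addr_ge0. Qed.

Let L0 : 0 <= L. Proof. by rewrite mulr_ge0. Qed.

(* Extend the segment from y to x by a unit length beyond x, and use convexity
   along it. *)
Let minorant x y : `|x| <= r -> f x <= f y + L * `|x - y|.
Proof.
move=> xr; have [->|xy] := eqVneq x y; first by rewrite subrr normr0 mulr0 addr0.
set t := `|x - y|.
have t0 : 0 < t by rewrite normr_gt0 subr_eq0.
pose z := x + t^-1 *: (x - y).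
have zr : `|z| <= r + 1.
  apply: le_trans (ler_normD _ _) _; rewrite lerD// normrZ.
  rewrite ger0_norm ?invr_ge0 ?(ltW t0)//.
  by rewrite mulVf ?lt0r_neq0.
have t1 : 0 < 1 + t by rewrite addr_gt0.
pose s := t / (1 + t).
have s01 : 0 <= s <= 1.
  by rewrite /s divr_ge0 ?(ltW t0) ?(ltW t1)//= ler_pdivrMr// mul1r lerDr.
have s1 : s * (1 + t) = t by rewrite /s mulfVK// gt_eqF.
have xE : x = s *: z + (1 - s) *: y.
  have st : s * t^-1 = 1 - s.
    apply: (mulIf (lt0r_neq0 t0)); rewrite mulfVK ?lt0r_neq0//.
    by move: s1; rewrite mulrDr mulr1 mulrBl mul1r; move: (s * t) => u; lra.
  rewrite /z scalerDr scalerA st -addrA -scalerDr subrK -scalerDl.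
  by rewrite addrC subrK scale1r.
have := convP f z y s01; rewrite -xE => fx.
have := fM (x := x); rewrite ler_norml => /(_ _)/andP[].
  by rewrite (le_trans xr)// lerDl.
have := fM zr; rewrite ler_norml => /andP[z1 z2] x1 x2.
have h : (1 + t) * f x <= t * f z + f y.
  apply: le_trans (ler_wpM2l (ltW t1) fx) _.
  have -> : (1 + t) * (s * f z + (1 - s) * f y) =
    s * (1 + t) * f z + (1 + t - s * (1 + t)) * f y by ring.
  by rewrite s1 addrK mul1r.
(* Both [f z] and [f x] lie between [- M] and [M], hence the slope [L = 2 * M]. *)
have : t * (f z - f x) <= t * L by rewrite ler_pM2l// /L; lra.
by rewrite (mulrC L); lra.
Qed.

(** Obtained from [minorant] at 0 and the triangle inequality. It makes the infimum defining [g] a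
    genuine one. *)
Let lower x y : f 0 - L * `|x| <= f y + L * `|x - y|.
Proof.
have := @minorant 0 y; rewrite normr0 sub0r normrN => /(_ r0) h.
have : L * `|y| <= L * (`|x| + `|x - y|).
  rewrite ler_wpM2l// -{1}(subKr x y) (le_trans (ler_normB _ _))//.
by rewrite mulrDr; lra.
Qed.

Let slices x : set R := range (fun y => f y + L * `|x - y|).

Let slices_lb x : has_lbound (slices x).
Proof. by exists (f 0 - L * `|x|) => _ [y _ <-]. Qed.

Let slices_ne x : slices x !=set0.
Proof. by exists (f x + L * `|x - x|); exists x. Qed.

Let g x := inf (slices x).

Let g_le x y : g x <= f y + L * `|x - y|.
Proof. by apply: ge_inf => //; exists y. Qed.

(** The function [f y + L * |x - y|] is jointly convex in [x] and [y], so a convex combination of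
    near-minimizers for two points competes at their convex combination. *)
Let g_conv : g \in @is_Conv R n.
Proof.
apply: is_ConvP => t x y t01; apply/ler_addgt0Pr => e e0.
have /andP[t0 t1] := t01.
have [_ [a _ <-] ha] := inf_adherent e0 (conj (slices_ne x) (slices_lb x)).
have [_ [b _ <-] hb] := inf_adherent e0 (conj (slices_ne y) (slices_lb y)).
apply: le_trans (g_le _ (t *: a + (1 - t) *: b)) _.
have -> : t *: x + (1 - t) *: y - (t *: a + (1 - t) *: b) =
    t *: (x - a) + (1 - t) *: (y - b).
  by rewrite !scalerBr opprD addrACA.
have h1 : L * `|t *: (x - a) + (1 - t) *: (y - b)| <=
    L * (t * `|x - a| + (1 - t) * `|y - b|).
  rewrite ler_wpM2l// (le_trans (ler_normD _ _))// !normrZ !ger0_norm//.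
  by rewrite subr_ge0.
have h2 := convP f a b t01.
have t1' : 0 <= 1 - t by rewrite subr_ge0.
have h3 := ler_wpM2l t0 (ltW ha); have h4 := ler_wpM2l t1' (ltW hb).
rewrite -/(g x) in h3; rewrite -/(g y) in h4.
have := lerD h3 h4; rewrite !mulrDr.
move: h1 h2; rewrite !mulrDr (mulrCA L t) (mulrCA L (1 - t)).
have -> : t * g x + t * e + ((1 - t) * g y + (1 - t) * e) =
  t * g x + (1 - t) * g y + e by ring.
move: (t * f a) ((1 - t) * f b) => *; lra.
Qed.

Let g_lip x y : g x - g y <= L * `|x - y|.
Proof.
rewrite lerBlDr addrC -lerBlDr.
apply: lb_le_inf => // _ [z _ <-].
have := g_le x z.
have : L * `|x - z| <= L * (`|x - y| + `|y - z|).
  by rewrite ler_wpM2l// (le_trans _ (ler_normD _ _))// addrA subrK.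
by rewrite mulrDr; lra.
Qed.

Let g_eq x : `|x| <= r -> g x = f x.
Proof.
move=> xr; apply/eqP; rewrite eq_le; apply/andP; split.
  by have := g_le x x; rewrite subrr normr0 mulr0 addr0.
by apply: lb_le_inf => // _ [z _ <-]; exact: minorant.
Qed.

Lemma lipschitz_regularization : exists2 g : Conv R n,
  lipschitz_Conv (2 * M) g & forall x, `|x| <= r -> g x = f x.
Proof.
exists (MkConv g_conv) => //; split=> //=.
rewrite g_eq ?normr0// (le_trans (fM _)) ?normr0 ?addr_ge0//.
by rewrite ler_peMl// ler1n.
Qed.

End lipschitz_regularization.

(** * Test functions and Radon measures *)

Lemma normc_cvg_le (R : realType) (u : nat -> R[i]^o) (l a : R[i]^o) (c : R) :
  u @ \oo --> l -> (\forall i \near \oo, normc (a - u i) <= c) ->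
  normc (a - l) <= c.
Proof.
move=> /cvg_normcP ul hc; apply/ler_addgt0Pr => e e0.
near \oo => i.
rewrite -(subrK (u i) a) -addrA (le_trans (le_normcD _ _))// lerD//.
  by near: i.
by rewrite normcBC ltW//; near: i; exact: ul.
Unshelve. all: by end_near. Qed.

Section test_functions.
Context (R : realType) (n : nat).
Local Notation V := 'rV[R]_n.
Implicit Types (phi psi : Cc R n) (A : set V).

Lemma Cc_continuous phi : continuous (phi : V -> R[i]^o).
Proof. by case: phi => f fP /=; move: (fP); rewrite inE => -[]. Qed.

Lemma Cc_compact phi : compact (tsupport phi).
Proof. by case: phi => f fP /=; move: (fP); rewrite inE => -[]. Qed.

Lemma tsupport_subP (phi : V -> R[i]) A : closed A ->
  tsupport phi `<=` A <-> forall x, ~ A x -> phi x = 0.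
Proof.
move=> cA; split=> [h x nAx|h].
  by apply: contra_notP nAx => /eqP p0; apply: h; exact: subset_closure.
rewrite /tsupport (iffLR (closure_id A) cA); apply: closureS => x /=.
by apply: contra_neqP => /h.
Qed.

Lemma tsupport_out (phi : V -> R[i]) x : ~ tsupport phi x -> phi x = 0.
Proof.
by move=> nAx; apply: contra_notP nAx => /eqP p0; exact: subset_closure.
Qed.

(** Guarantees that [supnorm] is a true supremum and not the default value of [sup]. *)
Lemma Cc_bounded phi : exists M : R, forall x, normc (phi x) <= M.
Proof.
have /compact_near_coveringP cK := @Cc_compact phi.
have := @cK _ (pinfty_nbhs R) (fun M x => normc (phi x) <= M) _.
case=> [x _|M [_ hM]].
  have /cvg_normcP/(_ _ ltr01) h := @Cc_continuous phi x.
  exists ([set y | normc (phi x - phi y) < 1], [set M | normc (phi x) + 1 <= M]).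
    by split => //=; apply: nbhs_pinfty_ge; exact: num_real.
  move=> [y M] /= [hy]; apply: le_trans.
  rewrite -[phi y](subrK (phi x)); apply: le_trans (le_normcD _ _) _.
  by rewrite [leRHS]addrC lerD// normcBC ltW.
exists (`|M| + 1) => x; have [sx|sx] := pselect (tsupport phi x).
  by apply: hM => //; rewrite ltr_pwDr// ler_norm.
rewrite (tsupport_out sx).
by rewrite normc0 addr_ge0.
Qed.

Lemma supnorm_ub phi x : normc (phi x) <= supnorm phi.
Proof.
apply: ub_le_sup; last by exists x.
by have [M hM] := Cc_bounded phi; exists M => _ [y _ <-].
Qed.

Lemma supnorm_le phi (M : R) : (forall x, normc (phi x) <= M) -> supnorm phi <= M.
Proof.
by move=> h; apply: ge_sup; [exists (normc (phi 0)); exists 0|move=> _ [y _ <-]].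
Qed.

Lemma supnorm_ge0 phi : 0 <= supnorm phi.
Proof. exact: le_trans (normc_ge0 (phi 0)) (supnorm_ub _ _). Qed.

Lemma supnormZ (a : R[i]) phi : supnorm (a *: phi) <= normc a * supnorm phi.
Proof.
apply: supnorm_le => x; change (normc (a * phi x) <= normc a * supnorm phi).
by rewrite normcM ler_wpM2l ?normc_ge0// supnorm_ub.
Qed.

Lemma supnorm_eq0 phi : supnorm phi = 0 -> phi = 0.
Proof.
move=> p0; apply/val_inj/funext => x; apply/eq0_normc/eqP.
by rewrite eq_le normc_ge0 andbT -p0 supnorm_ub.
Qed.

Lemma tsupportZ (a : R[i]) phi : tsupport (a *: phi) `<=` tsupport phi.
Proof.
apply/tsupport_subP => [|x hx]; first exact: closed_closure.
change (a * phi x = 0).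
by rewrite (tsupport_out hx) mulr0.
Qed.

Lemma radon_linear (mu : radon R n) : linear mu.
Proof. by case: mu => f fP /=; move: (fP); rewrite inE => -[]. Qed.

Lemma radonD (mu : radon R n) phi psi : mu (phi + psi) = mu phi + mu psi.
Proof. by rewrite -[phi]scale1r radon_linear !scale1r. Qed.

Lemma radonZ (mu : radon R n) (a : R[i]) phi : mu (a *: phi) = a * mu phi.
Proof.
rewrite -[a *: phi]addr0 radon_linear.
suff -> : mu 0 = 0 by rewrite addr0.
have := radonD mu 0 0; rewrite addr0 => /eqP.
by rewrite -subr_eq0 opprD addrA subrr sub0r oppr_eq0 => /eqP.
Qed.

Lemma radonN (mu : radon R n) phi : mu (- phi) = - mu phi.
Proof. by rewrite -scaleN1r radonZ mulN1r. Qed.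

Lemma radon_bounded (mu : radon R n) A : compact A -> exists c : R,
  forall phi, tsupport phi `<=` A -> normc (mu phi) <= c * supnorm phi.
Proof. by case: mu => f fP /=; move: (fP); rewrite inE => -[_]; apply. Qed.

(** By homogeneity, [phi] is divided by its norm; a function of norm 0 vanishes and is treated
    apart. *)
Lemma radon_supnorm_le (mu : radon R n) A (c : R) :
  (forall phi, tsupport phi `<=` A -> supnorm phi <= 1 -> normc (mu phi) <= c) ->
  forall phi, tsupport phi `<=` A -> normc (mu phi) <= c * supnorm phi.
Proof.
move=> h phi sphi; have [p0|p0] := eqVneq (supnorm phi) 0.
  by rewrite p0 (supnorm_eq0 p0) -(scale0r 0) radonZ mul0r normc0 mulr0.
have pp : 0 < supnorm phi by rewrite lt_neqAle eq_sym p0 supnorm_ge0.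
rewrite -ler_pdivrMr//.
have -> : normc (mu phi) / supnorm phi = normc (mu ((supnorm phi)^-1%:C *: phi)).
  by rewrite radonZ normcM normc_real ger0_norm ?invr_ge0 ?(ltW pp)// mulrC.
apply: h; first exact: subset_trans (@tsupportZ _ _) sphi.
apply: le_trans (supnormZ _ _) _.
by rewrite normc_real ger0_norm ?invr_ge0 ?(ltW pp)// mulVf.
Qed.

End test_functions.

(** * Uniform boundedness principle for Radon measures *)

Section banach_steinhaus.
Context (R : realType) (n : nat).
Local Notation V := 'rV[R]_n.
Implicit Types (phi psi : Cc R n) (A : set V).

(** With ratio 1/3 the tail after step [k] is at most [3 / 2 * q ^+ k.+1 = q ^+ k / 2], below the
    fraction [2 / 3] of [q ^+ k] secured at step [k]. *)
Let q : R := 3^-1.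
Let q01 : 0 < q < 1. Proof. by apply/andP; split; rewrite /q; lra. Qed.
Let q0 k : 0 < q ^+ k. Proof. by rewrite exprn_gt0//; case/andP: q01. Qed.

Let qsmall (e : R) : 0 < e -> exists k, q ^+ k < e.
Proof.
move=> e0; have : (fun k => q ^+ k) @ \oo --> (0 : R).
  by apply: cvg_expr; case/andP: q01 => q0' q1; rewrite ger0_norm// ltW.
move=> /cvgrPdist_lt/(_ _ e0)[k _ /(_ k (leqnn k))] /=.
by rewrite sub0r normrN ger0_norm ?ltW//; exists k.
Qed.

Let Cc_limit (x : nat -> Cc R n) A : compact A ->
  (forall k, tsupport (x k) `<=` A) ->
  (forall k, supnorm (x k.+1 - x k) <= q ^+ k) ->
  exists phi, tsupport phi `<=` A /\
    forall k, supnorm (phi - x k) <= 3 / 2 * q ^+ k.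
Proof.
move=> cA xA xq.
(* Here [3 / 2 * q ^+ k] is the sum of all [q ^+ i] with [i >= k]; the right-hand side is the exact
   finite partial sum, so the induction closes. *)
have cauchy k i t : normc (x (k + i)%N t - x k t) <=
    3 / 2 * q ^+ k - 3 / 2 * q ^+ (k + i).
  elim: i => [|i ih]; first by rewrite addn0 !subrr normc0.
  rewrite addnS -(subrK (x (k + i)%N t) (x _ t)) -addrA.
  apply: le_trans (le_normcD _ _) _.
  have h : normc (x (k + i).+1 t - x (k + i)%N t) <= q ^+ (k + i).
    exact: le_trans (supnorm_ub (x (k + i).+1 - x (k + i)%N) t) (xq _).
  have -> : 3 / 2 * q ^+ k - 3 / 2 * q ^+ (k + i).+1 =
      q ^+ (k + i) + (3 / 2 * q ^+ k - 3 / 2 * q ^+ (k + i)).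
    by rewrite exprS /q; field.
  exact: lerD.
have cauchy' k i t : (k <= i)%N -> normc (x k t - x i t) <= 3 / 2 * q ^+ k.
  move=> ki; rewrite normcBC -(subnKC ki); apply: le_trans (cauchy _ _ _) _.
  by rewrite lerBlDr lerDl mulr_ge0// ltW.
have lim t : exists l : R[i]^o, ((fun k => x k t) : nat -> R[i]^o) @ \oo --> l.
  apply: normc_cauchy_cvg => e e0.
  have [|k hk] := @qsmall (e / 3); first by rewrite divr_gt0.
  exists k => i j ki kj.
  rewrite -(subrK (x k t) (x i t)) -addrA; apply: le_lt_trans (le_normcD _ _) _.
  have := cauchy' k i t ki; rewrite normcBC; have := cauchy' k j t kj.
  by move=> *; lra.
have [X hX] := choice lim.
have Xx k t : normc (X t - x k t) <= 3 / 2 * q ^+ k.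
  rewrite normcBC; apply: (normc_cvg_le (hX t)); exists k => // i /= ki.
  exact: cauchy'.
have X0 t : ~ A t -> X t = 0.
  move=> nAt; apply/eq0_normc/eqP; rewrite eq_le normc_ge0 andbT.
  rewrite -normcN -sub0r; apply: (normc_cvg_le (hX t)); apply: nearW => k.
  by rewrite tsupport_out ?subrr ?normc0// => /xA.
have Xcont : continuous (X : V -> R[i]^o).
  move=> t; apply: (iffRL (@cvg_normcP R _ _ X (X t) (nbhs_filter t))) => e e0.
  (* Each of the two tails is then below [3 / 2 * (e / 6) = e / 4]; with [e / 4] for the continuity
     of [x k], the total stays below [e]. *)
  have [|k hk] := @qsmall (e / 6); first by rewrite divr_gt0.
  have e2 : 0 < e / 4 by rewrite divr_gt0.
  have /cvg_normcP/(_ _ e2) := @Cc_continuous _ _ (x k) t.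
  apply: filterS => s hs.
  have -> : X t - X s = X t - x k t + (x k t - x k s) + (x k s - X s).
    by rewrite !addrA !subrK.
  apply: le_lt_trans (le_normcD _ _) _.
  have := le_normcD (X t - x k t) (x k t - x k s).
  have := Xx k t; have := Xx k s; rewrite normcBC.
  by move=> *; lra.
have clA : closed A by apply: compact_closed cA; exact: norm_hausdorff.
have sX : tsupport X `<=` A by apply/tsupport_subP.
have XC : X \in @is_Cc R n.
  rewrite inE; split => //; apply: subclosed_compact cA sX.
  exact: closed_closure.
exists (MkCc XC); split => // k.
by apply: supnorm_le => t; exact: Xx.
Qed.

(* Sokal's elementary proof of the uniform boundedness principle: adding or
   subtracting the k-th nearly maximizing function, scaled by 3^-k, one of the
   two partial sums is not shrunk by the k-th functional. *)
Lemma radon_banach_steinhaus (S : set (radon R n)) A : compact A ->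
  (forall phi, exists c : R, forall mu, S mu -> normc (mu phi) <= c) ->
  exists c : R, forall mu phi, S mu -> tsupport phi `<=` A ->
    supnorm phi <= 1 -> normc (mu phi) <= c.
Proof.
move=> cA Sb; apply: contrapT => /forallNP unb.
have clA : closed A by apply: compact_closed cA; exact: norm_hausdorff.
pose vals (mu : radon R n) := [set normc (mu phi) | phi in
  [set phi : Cc R n | tsupport phi `<=` A /\ supnorm phi <= 1]].
(* The operator norm of [mu] on the functions supported in [A]. *)
pose N mu := sup (vals mu).
have vals_ub mu : has_ubound (vals mu).
  have [c hc] := radon_bounded mu cA.
  exists `|c| => _ [phi [sphi phi1] <-]; apply: le_trans (hc phi sphi) _.
  apply: le_trans (ler_norm _) _; rewrite normrM ler_piMr//.
  by rewrite ger0_norm// supnorm_ge0.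
have N_ub (mu : radon R n) phi : tsupport phi `<=` A ->
    normc (mu phi) <= N mu * supnorm phi.
  move: phi; apply: radon_supnorm_le => phi sphi phi1.
  by apply: ub_le_sup => //; exists phi.
(* The final estimate keeps the fraction [2 / 3 - 1 / 2 = 1 / 6] of [q ^+ k * N mp.1]; the threshold
   is the value that makes this exceed [k]. *)
have pick k : exists mp : radon R n * Cc R n, [/\ S mp.1, tsupport mp.2 `<=` A,
    supnorm mp.2 <= 1, 6 * 3 ^+ k * k%:R < N mp.1 &
    2 / 3 * N mp.1 <= normc (mp.1 mp.2)].
  have /existsNP[mu /existsNP[phi /not_implyP[Smu]]] := unb (6 * 3 ^+ k * k%:R).
  move=> /not_implyP[sphi /not_implyP[phi1 /negP]]; rewrite -ltNge => big.
  have Nbig : 6 * 3 ^+ k * k%:R < N mu.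
    by apply: lt_le_trans big _; apply: ub_le_sup => //; exists phi.
  have N0 : 0 < N mu by apply: le_lt_trans Nbig; rewrite !mulr_ge0// exprn_ge0.
  have e0 : 0 < N mu / 3 by rewrite divr_gt0.
  have vals_ne : vals mu !=set0 by exists (normc (mu phi)); exists phi.
  have [_ [psi [spsi psi1] <-] hpsi] :=
    sup_adherent e0 (conj vals_ne (vals_ub mu)).
  exists (mu, psi); split=> //=; rewrite -/(N mu) in hpsi.
  by apply: ltW; apply: le_lt_trans hpsi; lra.
have [mp hmp] := choice pick.
pose mu k := (mp k).1.
pose xi k : Cc R n := (q ^+ k)%:C *: (mp k).2.
pose step k (y : Cc R n) := if normc (mu k (xi k)) <= normc (mu k (y + xi k))
  then y + xi k else y - xi k.
pose x := fix x k := if k is k'.+1 then step k' (x k') else 0.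
have xS k : x k.+1 = x k + xi k \/ x k.+1 = x k - xi k.
  by rewrite /= /step; case: ifP; [left|right].
have sxi k : tsupport (xi k) `<=` A.
  have [_ h _ _ _] := hmp k; exact: subset_trans (@tsupportZ _ _ _ _) h.
have xi1 k : supnorm (xi k) <= q ^+ k.
  have [_ _ h _ _] := hmp k; apply: le_trans (supnormZ _ _) _.
  by rewrite normc_real ger0_norm ?(ltW (q0 k))// ler_piMr// ltW.
have xq k : supnorm (x k.+1 - x k) <= q ^+ k.
  case: (xS k) => ->; rewrite addrC addKr//.
  by rewrite -scaleN1r (le_trans (supnormZ _ _))// normcN normc1 mul1r.
have sx k : tsupport (x k) `<=` A.
  elim: k => [|k ih]; apply/tsupport_subP => // t nAt.
  have x0 := iffLR (tsupport_subP (x k) clA) ih t nAt.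
  have xi0 := iffLR (tsupport_subP (xi k) clA) (sxi k) t nAt.
  case: (xS k) => ->.
    by change (x k t + xi k t = 0); rewrite x0 xi0 addr0.
  by change (x k t - xi k t = 0); rewrite x0 xi0 subr0.
(* The values at [x k + xi k] and [x k - xi k] differ by twice the value at [xi k], so one of them
   is at least as large in modulus as the value at [xi k]. *)
have xbig k : normc (mu k (xi k)) <= normc (mu k (x k.+1)).
  rewrite /= /step; case: ifPn => //; rewrite -ltNge => h.
  have E : mu k (x k - xi k) - mu k (x k + xi k) = - (mu k (xi k) *+ 2).
    by rewrite !radonD radonN; ring.
  have := le_normcD (mu k (x k - xi k)) (- mu k (x k + xi k)).
  rewrite E !normcN normcMn => h'.
  move: h'; rewrite mulr2n => h'; lra.
have [phi [sphi hphi]] := Cc_limit cA sx xq.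
have [c hc] := Sb phi.
have [k hk] : exists k, c < k%:R.
  exists (Num.bound `|c|).
  exact: le_lt_trans (ler_norm c) (archi_boundP (normr_ge0 c)).
have [Smu smp mp1 Nbig mpbig] := hmp k.
rewrite -/(mu k) in Smu Nbig mpbig.
(* Passing from [x k.+1] to [phi] costs at most [N (mu k) * q ^+ k / 2], while [mu k (x k.+1)] has
   modulus at least [2 / 3 * q ^+ k * N (mu k)]. *)
have : k%:R <= normc (mu k phi).
  have sd : tsupport (phi - x k.+1) `<=` A.
    apply/tsupport_subP => // t nAt; change (phi t - x k.+1 t = 0).
    rewrite (iffLR (tsupport_subP phi clA) sphi t nAt).
    by rewrite (iffLR (tsupport_subP (x k.+1) clA) (sx _) t nAt) subr0.
  have N0 : 0 < N (mu k) by apply: le_lt_trans Nbig; rewrite !mulr_ge0// exprn_ge0.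
  have h1 := le_trans (N_ub (mu k) _ sd) (ler_wpM2l (ltW N0) (hphi k.+1)).
  have h2 := xbig k.
  rewrite /xi radonZ normcM normc_real ger0_norm in h2; last exact: ltW.
  have h3 := le_trans (ler_wpM2l (ltW (q0 k)) mpbig) h2.
  have h4 := le_normcD (mu k phi) (- (mu k (phi - x k.+1))).
  rewrite normcN radonD radonN opprD opprK addrA subrr add0r in h4.
  have h5 : 3 / 2 * q ^+ k.+1 = q ^+ k / 2 by rewrite exprS /q; field.
  rewrite h5 in h1.
  have h6 : q ^+ k * (6 * 3 ^+ k * k%:R) < q ^+ k * N (mu k) by rewrite ltr_pM2l.
  have h7 : q ^+ k * (6 * 3 ^+ k * k%:R) = 6 * k%:R.
    by rewrite mulrA (mulrC 6) mulrA -exprMn /q mulVf// expr1n mul1r.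
  rewrite h7 in h6.
  have h8 : N (mu k) * (q ^+ k / 2) = q ^+ k * N (mu k) / 2 by ring.
  have h9 : q ^+ k * (2 / 3 * N (mu k)) = q ^+ k * N (mu k) * 2 / 3 by ring.
  rewrite h8 in h1; rewrite h9 in h3.
  rewrite radonD radonN in h1.
  move: (q ^+ k * N (mu k)) h1 h3 h6 => u; lra.
by move=> h; have := hc _ Smu; lra.
Qed.

End banach_steinhaus.

(** * Limits of polynomial maps *)

Section interpolation.
Context (R : realType) (m d : nat).
Local Notation idx := {ffun 'I_m -> 'I_d.+1}.

Let node (be : idx) : 'rV[R]_m := \row_i (be i)%:R.

Let vdm : 'M[R]_d.+1 := Vandermonde d.+1 (\row_(j < d.+1) j%:R).

Let vdm_unit : vdm \in unitmx.
Proof.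
rewrite unitmxE det_Vandermonde unitfE.
apply/prodf_neq0 => i _; apply/prodf_neq0 => j ij.
by rewrite !mxE subr_eq0 eqr_nat gtn_eqF.
Qed.

Let weight (al be : idx) : R := \prod_i invmx vdm (be i) (al i).

(** The sum over the grid factors into one sum per coordinate, each an entry of the product of [vdm]
    with its inverse. *)
Let weight_dual (al al' : idx) :
  \sum_be weight al be * \prod_i node be 0 i ^+ al' i = (al' == al)%:R.
Proof.
pose G i (b : 'I_d.+1) := vdm (al' i) b * invmx vdm b (al i).
transitivity (\sum_(be : idx) \prod_i G i (be i)).
  apply: eq_bigr => be _; rewrite -big_split; apply: eq_bigr => i _.
  by rewrite /G !mxE mulrC.
rewrite -bigA_distr_bigA.
have E i : \sum_b G i b = (al' i == al i)%:R.
  by have := mulmxV vdm_unit => /matrixP/(_ (al' i) (al i)); rewrite !mxE.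
under eq_bigr do rewrite E.
have [->|ne] := eqVneq al' al; first by rewrite big1// => i _; rewrite eqxx.
have [i ii] : exists i, al' i != al i.
  by apply/existsP; apply: contra_neqT ne => /existsPn h; apply/ffunP => i;
    apply/eqP; have := h i; rewrite negbK.
by rewrite (bigD1 i)//= (negbTE ii) mul0r.
Qed.

(* Interpolation on the grid {0, ..., d}^m by inverting Vandermonde matrices in
   each coordinate. *)
Lemma polynomial_interpolation : exists (w : idx -> idx -> R)
    (p : idx -> 'rV[R]_m), forall (V : lmodType R[i]) (F : 'rV[R]_m -> V),
  polynomial_map d F -> forall l, F l =
    \sum_(al : idx | (\sum_i al i <= d)%N) (\prod_i l 0 i ^+ al i)%:C *:
      \sum_be (w al be)%:C *: F (p be).
Proof.
exists weight, node => V F [c Fc] l; rewrite [LHS]Fc.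
apply: eq_bigr => al ald; congr (_ *: _).
under eq_bigr do rewrite Fc scaler_sumr.
rewrite exchange_big /= (bigD1 al)//= [X in _ + X]big1 => [|al' /andP[_ ne]].
  under eq_bigr do rewrite scalerA -rmorphM.
  by rewrite -scaler_suml -rmorph_sum /= weight_dual eqxx scale1r addr0.
under eq_bigr do rewrite scalerA -rmorphM.
by rewrite -scaler_suml -rmorph_sum /= weight_dual (negbTE ne) scale0r.
Qed.

End interpolation.

Section polynomial_limit.
Context (R : realType) (n m d : nat).

Lemma radon_sumE (I : Type) (s : seq I) (P : pred I) (F : I -> radon R n)
    (phi : Cc R n) :
  (\sum_(i <- s | P i) F i) phi = \sum_(i <- s | P i) F i phi.
Proof. by apply: (big_morph (fun mu : radon R n => mu phi)). Qed.

Lemma radon_ext (mu nu : radon R n) : (forall phi, mu phi = nu phi) -> mu = nu.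
Proof. by move=> h; apply/val_inj/funext. Qed.

Let radon_combE (I J : finType) (P : pred I) (a : I -> R[i]) (b : I -> J -> R[i])
    (F : J -> radon R n) (phi : Cc R n) :
  (\sum_(i | P i) a i *: \sum_j b i j *: F j) phi =
  \sum_(i | P i) a i * \sum_j b i j * F j phi.
Proof.
rewrite radon_sumE; apply: eq_bigr => i _.
change (a i * (\sum_j b i j *: F j) phi = a i * \sum_j b i j * F j phi).
by rewrite radon_sumE.
Qed.

(** Pointwise convergence suffices: the interpolation formula involves finitely many values with
    weights independent of [k], so it passes to the limit and supplies the coefficients of [G]. *)
Lemma polynomial_map_lim (F : nat -> 'rV[R]_m -> radon R n)
    (G : 'rV[R]_m -> radon R n) :
  (forall k, polynomial_map d (F k)) ->
  (forall l phi,
    ((fun k => F k l phi) : nat -> R[i]^o) @ \oo --> (G l phi : R[i]^o)) ->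
  polynomial_map d G.
Proof.
move=> polF FG.
have [w [p wp]] := @polynomial_interpolation R m d.
exists (fun al => \sum_be (w al be)%:C *: G (p be)) => l.
apply: radon_ext => phi.
apply: (cvg_unique (@norm_hausdorff _ R[i]^o) (FG l phi)).
have -> : (fun k => F k l phi) = fun k =>
    \sum_(al : {ffun 'I_m -> 'I_d.+1} | (\sum_i al i <= d)%N)
    (\prod_i l 0 i ^+ al i)%:C * \sum_be (w al be)%:C * F k (p be) phi.
  by apply/funext => k; rewrite (wp _ _ (polF k)) radon_combE.
rewrite radon_combE.
apply: (cvg_big (@add_continuous R[i]^o)) => al _; apply: (@cvgZl_tmp _ R[i]^o).
apply: (cvg_big (@add_continuous R[i]^o)) => be _; apply: (@cvgZl_tmp _ R[i]^o).
exact: FG.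
Qed.

End polynomial_limit.

(** * Seminorms *)

Section seminorms.
Context (R : realType) (n d : nat).
Local Notation V := 'rV[R]_n.
Local Notation E := (PdLV R n d).
Implicit Types (Psi Phi : E) (A : set V) (K : set (Conv R n)).
Implicit Types (f g : Conv R n) (phi : Cc R n).

Lemma PdLV_continuous Psi (phi : Cc R n) :
  continuous (fun f => Psi f phi : R[i]^o).
Proof.
case: Psi => P PP; have := PP; rewrite inE => -[/continuous_radonP cP _ _].
exact: cP.
Qed.

Lemma PdLV_local Psi : local_functional Psi.
Proof. by case: Psi => P PP; have := PP; rewrite inE => -[]. Qed.

Lemma PdLV_polynomial Psi : polynomial_functional d Psi.
Proof. by case: Psi => P PP; have := PP; rewrite inE => -[]. Qed.

Lemma PdLV_ext Psi Phi : (forall f phi, Psi f phi = Phi f phi) -> Psi = Phi.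
Proof.
by move=> h; apply/val_inj/funext => f; apply: radon_ext => phi; exact: h.
Qed.

(** For fixed [phi], continuity bounds [Psi f phi] over the compact [K]; the measures [Psi f] are
    thus pointwise bounded, and uniform boundedness applies. *)
Lemma ctb_bounded A K Psi : compact A -> compact K ->
  exists c : R, forall f phi, K f -> tsupport phi `<=` A -> supnorm phi <= 1 ->
    normc (Psi f phi) <= c.
Proof.
move=> cA /compact_near_coveringP cK.
have [phi|c hc] := @radon_banach_steinhaus R n [set Psi f | f in K] A cA.
  have := @cK _ (pinfty_nbhs R) (fun M f => normc (Psi f phi) <= M) _.
  case=> [f _|M [_ hM]].
    have /cvg_normcP/(_ _ ltr01) h := @PdLV_continuous Psi phi f.
    exists ([set g | normc (Psi f phi - Psi g phi) < 1],
        [set M | normc (Psi f phi) + 1 <= M]).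
      by split => //=; apply: nbhs_pinfty_ge; exact: num_real.
    move=> [g M] /= [hg]; apply: le_trans.
    rewrite -[Psi g phi](subrK (Psi f phi)); apply: le_trans (le_normcD _ _) _.
    by rewrite [leRHS]addrC lerD// normcBC ltW.
  exists (M + 1) => _ [f Kf <-]; apply: (hM (M + 1)) => //.
  by rewrite ltrDl.
by exists c => f phi Kf; apply: hc; exists f.
Qed.

(** Meaningful for compact [A] and [K], where the seminorm is finite; [fine] would send an infinite
    value to 0. *)
Definition ctb_norm A K Psi : R := fine (ctb_seminorm A K Psi).

Lemma ctb_seminorm_fin A K Psi : compact A -> compact K ->
  ctb_seminorm A K Psi = (ctb_norm A K Psi)%:E.
Proof.
move=> cA cK; rewrite fineK// fin_numE /ctb_seminorm; apply/andP; split.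
  by rewrite -ltNye lt_max ltNyr.
have [c hc] := ctb_bounded Psi cA cK.
rewrite -ltey gt_max ltry /=; apply: (@le_lt_trans _ _ c%:E); last exact: ltry.
apply: ge_ereal_sup => _ [f [phi [Kf sphi phi1 ->]]].
by rewrite lee_fin; exact: hc.
Qed.

Section fixed.
Variables (A : set V) (K : set (Conv R n)).
Hypotheses (cA : compact A) (cK : compact K).

Lemma ctb_norm_le Psi (c : R) : 0 <= c ->
  (forall f phi, K f -> tsupport phi `<=` A -> supnorm phi <= 1 ->
    normc (Psi f phi) <= c) -> ctb_norm A K Psi <= c.
Proof.
move=> c0 h; rewrite -lee_fin -ctb_seminorm_fin// ge_max lee_fin c0 /=.
apply: ge_ereal_sup => _ [f [phi [Kf sphi phi1 ->]]].
by rewrite lee_fin; exact: h.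
Qed.

Lemma ctb_norm_ge0 Psi : 0 <= ctb_norm A K Psi.
Proof. by rewrite -lee_fin -ctb_seminorm_fin// le_max lexx. Qed.

Lemma ctb_norm_ub1 Psi f phi : K f -> tsupport phi `<=` A -> supnorm phi <= 1 ->
  normc (Psi f phi) <= ctb_norm A K Psi.
Proof.
move=> Kf sphi phi1; rewrite -lee_fin -ctb_seminorm_fin// le_max; apply/orP; right.
by apply: ereal_sup_ubound; exists f, phi.
Qed.

Lemma ctb_norm_ub Psi f phi : K f -> tsupport phi `<=` A ->
  normc (Psi f phi) <= ctb_norm A K Psi * supnorm phi.
Proof.
move=> Kf; move: phi; apply: radon_supnorm_le => phi sphi phi1.
exact: ctb_norm_ub1.
Qed.

Lemma ctb_normD Psi Phi :
  ctb_norm A K (Psi + Phi) <= ctb_norm A K Psi + ctb_norm A K Phi.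
Proof.
apply: ctb_norm_le => [|f phi Kf sphi phi1].
  by rewrite addr_ge0 ?ctb_norm_ge0.
change (normc (Psi f phi + Phi f phi) <= ctb_norm A K Psi + ctb_norm A K Phi).
by apply: le_trans (le_normcD _ _) _; rewrite lerD ?ctb_norm_ub1.
Qed.

Lemma ctb_normZ (a : R[i]) Psi :
  ctb_norm A K (a *: Psi) <= normc a * ctb_norm A K Psi.
Proof.
apply: ctb_norm_le => [|f phi Kf sphi phi1].
  by rewrite mulr_ge0 ?ctb_norm_ge0// normc_ge0.
change (normc (a * Psi f phi) <= normc a * ctb_norm A K Psi).
by rewrite normcM ler_wpM2l ?normc_ge0// ctb_norm_ub1.
Qed.

Lemma ctb_norm0 : ctb_norm A K 0 = 0.
Proof.
apply/eqP; rewrite eq_le ctb_norm_ge0 andbT.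
by apply: ctb_norm_le => // f phi _ _ _; rewrite normc0.
Qed.

Lemma ctb_normN Psi : ctb_norm A K (- Psi) = ctb_norm A K Psi.
Proof.
have h Phi : ctb_norm A K (- Phi) <= ctb_norm A K Phi.
  by rewrite -scaleN1r (le_trans (ctb_normZ _ _))// normcN normc1 mul1r.
by apply/eqP; rewrite eq_le h /= -{1}[Psi]opprK h.
Qed.

Lemma ctb_normBC Psi Phi : ctb_norm A K (Psi - Phi) = ctb_norm A K (Phi - Psi).
Proof. by rewrite -ctb_normN opprB. Qed.

Lemma ctb_norm_triangle Psi Phi Xi :
  ctb_norm A K (Psi - Xi) <= ctb_norm A K (Psi - Phi) + ctb_norm A K (Phi - Xi).
Proof. by apply: le_trans (ctb_normD _ _); rewrite addrA subrK. Qed.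

End fixed.

Definition knorm (j : nat) Psi : R :=
  ctb_norm (cball j%:R) (lipschitz_Conv j%:R) Psi.

Lemma knorm_mono i j Psi : (i <= j)%N -> knorm i Psi <= knorm j Psi.
Proof.
move=> ij; apply: ctb_norm_le.
- exact: compact_cball.
- exact: compact_lipschitz_Conv.
- by apply: ctb_norm_ge0; [exact: compact_cball|exact: compact_lipschitz_Conv].
move=> f phi [f0 fl] sphi phi1; apply: ctb_norm_ub1 => //.
- exact: compact_cball.
- exact: compact_lipschitz_Conv.
- split; first by rewrite (le_trans f0)// ler_nat.
  by move=> x y; rewrite (le_trans (fl x y))// ler_wpM2r// ler_nat.
- by apply: subset_trans sphi _ => x /= /le_trans; apply; rewrite ler_nat.
Qed.

(* Locality: only the values of [f] near the support of [phi] matter, so [f] may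
   be replaced by its Lipschitz regularization, which lies in a fixed compact
   set. *)
Lemma bounded_eval_le (r M : R) : exists j : nat, forall f,
  (forall x, `|x| <= `|r| + 2 -> `|f x| <= M) ->
  forall Psi phi, tsupport phi `<=` cball r ->
  normc (Psi f phi) <= knorm j Psi * supnorm phi.
Proof.
(* One index dominates both the radius [r] and the Lipschitz constant [2 * M]. *)
pose j := Num.bound (`|r| + `|2 * M|).
have jb : `|r| + `|2 * M| < j%:R by apply: archi_boundP; rewrite addr_ge0.
have jr : r <= j%:R.
  by rewrite (le_trans (ler_norm r))// ltW// (le_lt_trans _ jb)// lerDl.
have jM : 2 * M <= j%:R.
  by rewrite (le_trans (ler_norm _))// ltW// (le_lt_trans _ jb)// lerDr.
exists j => f fM Psi phi sphi.
(* Locality requires agreement on an open set around the support, hence radius [|r| + 1];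
   regularizing there uses the bound on radius [|r| + 2]. *)
have [||g [g0 gl] gf] := @lipschitz_regularization R n f (`|r| + 1) M.
- by rewrite addr_ge0.
- by move=> x xr; apply: fM; move: xr; lra.
have -> : Psi f phi = Psi g phi.
  apply: (@PdLV_local Psi [set x | `|x| < `|r| + 1]).
  - have := @open_comp _ _ (@Num.norm R V) [set s | s < `|r| + 1].
    by apply; [move=> x _; exact: norm_continuous|exact: open_lt].
  - by move=> x /= xr; rewrite gf// ltW.
  - move=> x /sphi /= xr; rewrite /cball /= in xr.
    by rewrite (le_lt_trans xr)// (le_lt_trans (ler_norm r))// ltrDl.
apply: ctb_norm_ub.
- exact: compact_cball.
- exact: compact_lipschitz_Conv.
- split; first exact: le_trans jM.
  by move=> x y; rewrite (le_trans (gl x y))// ler_wpM2r.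
- by apply: subset_trans sphi _ => x /= xr; exact: le_trans jr.
Qed.

Lemma compact_sub_cball A : compact A -> exists r : R, A `<=` cball r.
Proof.
move=> /compact_bounded[M [_ hM]]; exists (M + 1) => x Ax.
by apply: (hM (M + 1)) => //; rewrite ltrDl.
Qed.

Lemma ctb_norm_le_knorm A K : compact A -> compact K ->
  exists j, forall Psi, ctb_norm A K Psi <= knorm j Psi.
Proof.
move=> cA cK; have [r Ar] := compact_sub_cball cA.
have [M KM] := @compact_Conv_bounded R n K (`|r| + 2) cK.
have [j hj] := bounded_eval_le r M; exists j => Psi.
have k0 : 0 <= knorm j Psi.
  by apply: ctb_norm_ge0; [exact: compact_cball|exact: compact_lipschitz_Conv].
apply: ctb_norm_le => // f phi Kf sphi phi1.
apply: le_trans (hj f (KM f Kf) Psi phi (subset_trans sphi Ar)) _.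
by rewrite ler_piMr.
Qed.

(** The index is uniform over a neighbourhood of [f] and over all [Psi]; this is what makes limits
    of Cauchy sequences continuous. Functions within 1 of [f] on the larger ball are bounded by
    [M + 1]. *)
Lemma near_eval_le f A : compact A -> exists j : nat,
  nbhs f [set g | forall Psi phi, tsupport phi `<=` A ->
    normc (Psi g phi) <= knorm j Psi * supnorm phi].
Proof.
move=> cA; have [r Ar] := compact_sub_cball cA.
have [M fM] := conv_bounded f (`|r| + 2).
have [j hj] := bounded_eval_le r (M + 1); exists j.
apply: filterS (@nbhs_Conv R n f _ 1 (@compact_cball R n (`|r| + 2)) ltr01).
move=> g hg Psi phi sphi; apply: hj; last exact: subset_trans Ar.
move=> x xr; rewrite -[g x](subrK (f x)) (le_trans (ler_normD _ _))// addrC.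
by rewrite lerD ?fM// distrC ltW ?hg.
Qed.

End seminorms.

(** * Topology and completeness *)

Section ctb_topology.
Context (R : realType) (n d : nat).
Local Notation E := (PdLV R n d).
Implicit Types (Psi Phi : E) (U : set E).

Let cb j := @compact_cball R n j%:R.
Let cl j := @compact_lipschitz_Conv R n j%:R.

Definition kball (j : nat) Psi (e : R) : set E :=
  [set Phi | knorm j (Phi - Psi) < e].

Lemma open_subbase U : ctb_subbase U -> open U.
Proof.
move=> sU; exists [set U]; last first.
  by rewrite bigcup_set1.
move=> _ ->; exists [fset U]%fset.
  by move=> X; rewrite in_fset1 => /eqP ->; exact/mem_set.
by rewrite set_fset1 bigcap_set1.
Qed.

Lemma open_kball j Psi (e : R) : 0 < e -> open (kball j Psi e).
Proof.
move=> e0; apply: open_subbase.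
exists (cball j%:R), (lipschitz_Conv j%:R), Psi, e; split=> //.
by apply/seteqP; split => Phi; rewrite /kball /knorm /= ctb_seminorm_fin ?lte_fin.
Qed.

Lemma knorm0 j : knorm j (0 : E) = 0.
Proof. exact: (ctb_norm0 d (@cb j) (@cl j)). Qed.

Lemma knorm_triangle j Psi Phi (Xi : E) :
  knorm j (Psi - Xi) <= knorm j (Psi - Phi) + knorm j (Phi - Xi).
Proof. exact: (ctb_norm_triangle (@cb j) (@cl j)). Qed.

Lemma knorm_ge0 j Psi : 0 <= knorm j Psi.
Proof. exact: (ctb_norm_ge0 (@cb j) (@cl j)). Qed.

Lemma knormBC j Psi Phi : knorm j (Psi - Phi) = knorm j (Phi - Psi).
Proof. exact: (ctb_normBC (@cb j) (@cl j)). Qed.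

Lemma knormD j Psi Phi : knorm j (Psi + Phi) <= knorm j Psi + knorm j Phi.
Proof. exact: (ctb_normD (@cb j) (@cl j)). Qed.

Lemma knormZ j (a : R[i]) Psi : knorm j (a *: Psi) <= normc a * knorm j Psi.
Proof. exact: (ctb_normZ (@cb j) (@cl j)). Qed.

(** The candidate neighbourhood filter; being a filter, it absorbs the finite intersections of
    subbasic sets. *)
Let kfilter Psi : set_system E :=
  [set U | exists j, exists2 e : R, 0 < e & kball j Psi e `<=` U].

Let kfilter_filter Psi : Filter (kfilter Psi).
Proof.
split.
- by exists 0%N, 1.
- move=> U W [i [a a0 hU]] [j [b b0 hW]].
  exists (maxn i j), (Num.min a b); first by rewrite lt_min a0.
  move=> Phi; rewrite /kball /= lt_min => /andP[h1 h2].
  split; [apply: hU|apply: hW] => /=.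
    exact: le_lt_trans (knorm_mono _ (leq_maxl _ _)) h1.
  exact: le_lt_trans (knorm_mono _ (leq_maxr _ _)) h2.
- by move=> U W UW [j [e e0 h]]; exists j, e => // Phi /h /UW.
Qed.

Let kfilter_subbase Psi U : ctb_subbase U -> U Psi -> kfilter Psi U.
Proof.
move=> [A [K [Psi0 [e [cA cK e0 ->]]]]] /=.
rewrite ctb_seminorm_fin// lte_fin => Psie.
have [j hj] := ctb_norm_le_knorm d cA cK.
exists j, (e - ctb_norm A K (Psi - Psi0)); first by rewrite subr_gt0.
move=> Phi; rewrite /kball /= ltrBrDr => h.
rewrite (ctb_seminorm_fin (Phi - Psi0) cA cK) lte_fin.
apply: le_lt_trans h.
by apply: le_trans (ctb_norm_triangle cA cK Phi Psi Psi0) _; rewrite lerD2r.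
Qed.

(** Since [knorm] increases with its index and dominates every seminorm, a single ball replaces a
    finite intersection of subbasic sets. *)
Lemma nbhs_PdLVP Psi U : nbhs Psi U <->
  exists j, exists2 e : R, 0 < e & kball j Psi e `<=` U.
Proof.
split=> [[B [[D sD <-] [W DW WPsi] BU]]|[j [e e0 h]]].
  have FF := kfilter_filter Psi.
  have [T sT WE] := sD W DW.
  suff kW : kfilter Psi W.
    by apply: filterS kW => Phi WPhi; apply: BU; exists W.
  rewrite -WE; apply: filter_bigI => X XT.
  have sX : ctb_subbase X by exact: set_mem (sT X XT).
  by apply: kfilter_subbase => //; move: WPsi; rewrite -WE; apply.
apply: filterS h _; apply: open_nbhs_nbhs; split; first exact: open_kball.
by rewrite /kball /= subrr knorm0.
Qed.

Lemma PdLV_add_continuous : continuous (fun z : E * E => z.1 + z.2).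
Proof.
move=> [Psi Phi] U /nbhs_PdLVP[j [e e0 h]].
have e2 : 0 < e / 2 by rewrite divr_gt0.
exists (kball j Psi (e / 2), kball j Phi (e / 2)).
  by split; apply/nbhs_PdLVP; exists j, (e / 2).
move=> [Psi' Phi'] /= [h1 h2]; apply: h; rewrite /kball /=.
rewrite opprD addrACA; apply: le_lt_trans (knormD _ _ _) _.
by rewrite (splitr e) ltrD.
Qed.

Lemma PdLV_scale_continuous : continuous (fun z : R[i]^o * E => z.1 *: z.2).
Proof.
move=> [a Psi] U /nbhs_PdLVP[j [e e0 h]].
pose k := knorm j Psi.
have k1 : 0 < k + 1 by rewrite ltr_wpDl// knorm_ge0.
(* The difference splits as [b *: (Phi - Psi) + (b - a) *: Psi]. The choice of [e1] bounds the
   second term by [e / 2], and [e2] the first, given [normc b <= normc a + e1]. *)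
pose e1 := e / 2 / (k + 1).
pose e2 := e / 2 / (normc a + e1).
have e10 : 0 < e1 by rewrite !divr_gt0.
have ae1 : 0 < normc a + e1 by rewrite ltr_wpDl// normc_ge0.
have e20 : 0 < e2 by rewrite !divr_gt0.
exists ([set b : R[i]^o | normc (a - b) < e1], kball j Psi e2).
  by split; [apply/nbhs_normcP; exists e1|apply/nbhs_PdLVP; exists j, e2].
move=> [b Phi] /= [ab hPhi]; apply: h; rewrite /kball /=.
have -> : b *: Phi - a *: Psi = b *: (Phi - Psi) + (b - a) *: Psi.
  by rewrite scalerBr scalerBl addrA subrK.
apply: le_lt_trans (knormD _ _ _) _.
have h1 := knormZ j b (Phi - Psi); have h2 := knormZ j (b - a) Psi.
rewrite normcBC in h2.
have bn : normc b <= normc a + e1.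
  rewrite -[b](subrK a) (le_trans (le_normcD _ _))// addrC lerD2l normcBC.
  exact: ltW.
have h3 : normc b * knorm j (Phi - Psi) <= (normc a + e1) * knorm j (Phi - Psi).
  by rewrite ler_wpM2r// knorm_ge0.
have h4 : (normc a + e1) * knorm j (Phi - Psi) < e / 2.
  have -> : e / 2 = (normc a + e1) * e2 by rewrite /e2 mulrCA divff ?mulr1// gt_eqF.
  by rewrite ltr_pM2l.
have h5 : normc (a - b) * k <= e1 * k by rewrite ler_wpM2r ?knorm_ge0// ltW.
have h6 : e1 * (k + 1) = e / 2 by rewrite /e1 mulfVK// gt_eqF.
rewrite mulrDr mulr1 in h6.
rewrite -/k in h2; lra.
Qed.

Let kball_conv j Psi (e r : R) (x y : E) : 0 <= r <= 1 ->
  kball j Psi e x -> kball j Psi e y ->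
  kball j Psi e (r%:C *: x + (1 - r)%:C *: y).
Proof.
rewrite /kball /= => /andP[r0 r1] hx hy.
have -> : r%:C *: x + (1 - r)%:C *: y - Psi =
    r%:C *: (x - Psi) + (1 - r)%:C *: (y - Psi).
  have rr : r%:C + (1 - r)%:C = 1 by rewrite -rmorphD addrC subrK.
  by rewrite !scalerBr addrACA -opprD -scalerDl rr scale1r.
apply: le_lt_trans (knormD _ _ _) _.
have h1 := knormZ j r%:C (x - Psi); have h2 := knormZ j (1 - r)%:C (y - Psi).
have r1' : 0 <= 1 - r by rewrite subr_ge0.
rewrite normc_real ger0_norm// in h1; rewrite normc_real ger0_norm// in h2.
apply: le_lt_trans (lerD h1 h2) _.
move: (knorm j (x - Psi)) (knorm j (y - Psi)) hx hy {h1 h2} => p p' hp hp'.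
(* Comparing with the maximum keeps the inequality strict also when [r] is 0 or 1. *)
have me : Num.max p p' < e by rewrite gt_max hp.
apply: le_lt_trans me; set m := Num.max p p'.
have -> : m = r * m + (1 - r) * m by ring.
by rewrite lerD// ler_wpM2l// le_max lexx ?orbT.
Qed.

Lemma convex_kball j Psi (e : R) : convex_set (kball j Psi e).
Proof.
move=> x y t /set_mem hx /set_mem hy; apply/mem_set.
(* The convexity parameter is a complex number; the order of [R[i]] forces it to be real. *)
have [r r01 tE] : exists2 r : R, 0 <= r <= 1 & t%:num = r%:C.
  have : 0 <= t%:num :> R[i] by [].
  have : t%:num <= 1 :> R[i] by rewrite le1.
  case: t%:num => a b; rewrite !lecE /= => /andP[/eqP b0 a1] /andP[_ a0].
  by exists a; rewrite ?a0// -b0.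
have tE' : 1 - t%:num = (1 - r)%:C :> R[i] by rewrite tE rmorphB.
have := kball_conv r01 hx hy; rewrite -tE -tE'.
exact.
Qed.

Lemma PdLV_convex_basis : exists2 B : set_system E,
  (forall b, b \in B -> convex_set b) & basis B.
Proof.
exists [set b | exists j Psi (e : R), 0 < e /\ b = kball j Psi e].
  by move=> b /set_mem[j [Psi [e [_ ->]]]]; exact: convex_kball.
split=> [_ [j [Psi [e [e0 ->]]]]|Psi U /nbhs_PdLVP[j [e e0 h]]].
  exact: open_kball.
exists (kball j Psi e) => //; split; first by exists j, Psi, e.
by rewrite /kball /= subrr knorm0.
Qed.

(** The caps [j.+1%:R^-1] tend to 0, so that at any given scale only finitely many norms count. *)
Definition ctb_dist Psi Phi : R :=
  sup (range (fun j : nat => Num.min j.+1%:R^-1 (knorm j (Psi - Phi)))).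

Lemma ctb_dist_ub j Psi Phi :
  Num.min j.+1%:R^-1 (knorm j (Psi - Phi)) <= ctb_dist Psi Phi.
Proof.
apply: ub_le_sup; last by exists j.
exists 1 => _ [i _ <-]; rewrite ge_min invf_le1 ?ltr0n//.
by rewrite ler1n.
Qed.

Lemma ctb_dist_le Psi Phi (c : R) :
  (forall j, Num.min j.+1%:R^-1 (knorm j (Psi - Phi)) <= c) ->
  ctb_dist Psi Phi <= c.
Proof.
move=> h; apply: ge_sup; last by move=> _ [j _ <-].
by exists (Num.min 1%:R^-1 (knorm 0 (Psi - Phi))); exists 0%N.
Qed.

Lemma ctb_dist_kball j (e : R) Psi Phi :
  ctb_dist Psi Phi < Num.min j.+1%:R^-1 e -> knorm j (Psi - Phi) < e.
Proof.
move=> h; have := le_lt_trans (ctb_dist_ub j Psi Phi) h.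
rewrite lt_min gt_min ltxx /= => /andP[h1].
by rewrite gt_min => /orP[/(lt_trans h1)|].
Qed.

(** Take [j] above [e^-1]: norms of larger index are capped below [e], and those of smaller index
    are dominated by [knorm j]. *)
Lemma kball_ctb_dist (e : R) : 0 < e -> exists j, forall Psi Phi,
  knorm j (Psi - Phi) < e -> ctb_dist Psi Phi <= e.
Proof.
move=> e0; have [j hj] : exists j : nat, e^-1 < j%:R.
  by exists (Num.bound e^-1); apply: archi_boundP; rewrite invr_ge0 ltW.
exists j => Psi Phi h; apply: ctb_dist_le => i; rewrite ge_min.
have [ij|ji] := leqP i j.
  by rewrite (ltW (le_lt_trans (knorm_mono _ ij) h)) orbT.
apply/orP; left; rewrite invf_ple ?posrE ?ltr0n//.
by rewrite (ltW (lt_le_trans hj _))// ler_nat ltnW// ltnW.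
Qed.

Lemma PdLV_subE Psi Phi f (phi : Cc R n) :
  (Psi - Phi) f phi = Psi f phi - Phi f phi.
Proof. by []. Qed.

Lemma PdLV_eval_le f (A : set 'rV[R]_n) : compact A ->
  exists j, forall Psi (phi : Cc R n),
  tsupport phi `<=` A -> normc (Psi f phi) <= knorm j Psi * supnorm phi.
Proof.
move=> /(near_eval_le d f)[j hj]; exists j.
exact: (nbhs_singleton hj).
Qed.

End ctb_topology.

(** * Limits of Cauchy sequences *)

Section completeness.
Context (R : realType) (n d : nat).
Local Notation E := (PdLV R n d).
Implicit Types (Psi Phi : E) (f g h : Conv R n) (phi psi : Cc R n).

Variable u : nat -> E.
Hypothesis u_cauchy : forall j (e : R), 0 < e ->
  exists N, forall a b, (N <= a)%N -> (N <= b)%N -> knorm j (u a - u b) < e.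

Let eval_cvg f phi : exists l : R[i]^o,
  ((fun k => u k f phi) : nat -> R[i]^o) @ \oo --> l.
Proof.
apply: normc_cauchy_cvg => e e0.
have [j hj] := PdLV_eval_le d f (@Cc_compact _ _ phi).
have s1 : 0 < supnorm phi + 1 by rewrite ltr_wpDl// supnorm_ge0.
have [N hN] := u_cauchy j (divr_gt0 e0 s1).
exists N => a b Na Nb.
have hab : normc (u a f phi - u b f phi) <= knorm j (u a - u b) * supnorm phi.
  exact: (hj (u a - u b) phi (@subset_refl _ _)).
apply: le_lt_trans hab _.
have := hN a b Na Nb; rewrite ltr_pdivlMr// mulrDr mulr1.
by have := knorm_ge0 j (u a - u b); lra.
Qed.

Let L f phi : R[i]^o := projT1 (cid (eval_cvg f phi)).

Let L_cvg f phi : ((fun k => u k f phi) : nat -> R[i]^o) @ \oo --> L f phi.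
Proof. exact: (projT2 (cid (eval_cvg f phi))). Qed.

Let L_unique f phi (l : R[i]^o) :
  ((fun k => u k f phi) : nat -> R[i]^o) @ \oo --> l -> L f phi = l.
Proof. exact: (cvg_unique (@norm_hausdorff _ R[i]^o) (@L_cvg f phi)). Qed.

(** Carries the Cauchy estimates over to the limit. *)
Let L_near f phi (k : nat) (c : R) :
  (\forall i \near \oo, normc ((u k - u i) f phi) <= c) ->
  normc (u k f phi - L f phi) <= c.
Proof.
move=> h; apply: (normc_cvg_le (@L_cvg f phi)).
by apply: filterS h => i; rewrite PdLV_subE.
Qed.

Let L_radon f : (L f : Cc R n -> R[i]^o) \in @is_radon R n.
Proof.
rewrite inE; split.
  move=> a phi psi; apply: L_unique.
  rewrite (_ : (fun k => _) = fun k => a *: (u k f phi : R[i]^o) + u k f psi).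
    apply: (@cvgD _ R[i]^o); last exact: L_cvg.
    by apply: (@cvgZl_tmp _ R[i]^o); exact: L_cvg.
  by apply/funext => k; rewrite radonD radonZ.
move=> A cA; have [j hj] := PdLV_eval_le d f cA.
have [N hN] := u_cauchy j ltr01.
exists (knorm j (u N) + 1) => phi sphi.
have h : normc (u N f phi - L f phi) <= 1 * supnorm phi.
  apply: L_near; exists N => // i /= Ni.
  apply: le_trans (hj (u N - u i) phi sphi) _; rewrite ler_wpM2r ?supnorm_ge0//.
  by rewrite ltW// hN.
rewrite -(subrK (u N f phi) (L f phi)) (le_trans (le_normcD _ _))//.
by rewrite normcBC mulrDl addrC lerD// hj.
Qed.

Let lim f : radon R n := MkRadon (L_radon f).

Let lim_continuous : continuous lim.
Proof.
apply/continuous_radonP => phi f.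
apply: (iffRL (@cvg_normcP R _ (nbhs f) _ _ (nbhs_filter f))) => e e0.
have [j hj] := near_eval_le d f (@Cc_compact _ _ phi).
have s1 : 0 < supnorm phi + 1 by rewrite ltr_wpDl// supnorm_ge0.
have e3 : 0 < e / 3 by rewrite divr_gt0.
have [N hN] := u_cauchy j (divr_gt0 e3 s1).
(* One [N] serves every [g] to which the evaluation bound with index [j] applies, hence a whole
   neighbourhood of [f]: the convergence is locally uniform. *)
have unif g : (forall Psi phi', tsupport phi' `<=` tsupport phi ->
    normc (Psi g phi') <= knorm j Psi * supnorm phi') ->
    normc (u N g phi - lim g phi) <= e / 3.
  move=> hg; apply: L_near; exists N => // i /= Ni.
  apply: le_trans (hg (u N - u i) phi (@subset_refl _ _)) _.
  have := hN N i (leqnn _) Ni; rewrite ltr_pdivlMr// mulrDr mulr1.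
  by have := knorm_ge0 j (u N - u i); lra.
have cN : nbhs f [set g : Conv R n | normc (u N f phi - u N g phi) < e / 3].
  exact: (iffLR (@cvg_normcP R _ (nbhs f) _ _ (nbhs_filter f))
    (@PdLV_continuous _ _ _ (u N) phi f) _ e3).
have hf := unif f (nbhs_singleton hj).
apply: (@filterS2 _ _ (nbhs_filter f) _ _ _ _ hj cN) => g hg cg.
have := unif g hg => {}hg.
have -> : lim f phi - lim g phi = (lim f phi - u N f phi) +
    (u N f phi - u N g phi) + (u N g phi - lim g phi).
  by rewrite !addrA !subrK.
apply: le_lt_trans (le_normcD _ _) _.
have := le_normcD (lim f phi - u N f phi) (u N f phi - u N g phi).
rewrite (normcBC (lim f phi)); rewrite /= in cg; lra.
Qed.

Let lim_local : local_functional lim.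
Proof.
move=> U f h oU fh phi sphi; apply: L_unique.
rewrite (_ : (fun k => _) = fun k => u k h phi); first exact: L_cvg.
by apply/funext => k; exact: (PdLV_local (u k) oU fh sphi).
Qed.

Let lim_polynomial : polynomial_functional d lim.
Proof.
move=> f.
apply: (@polynomial_map_lim R n _ d (fun k l => u k (add_affine f l))).
  by move=> k; exact: PdLV_polynomial.
by move=> l phi; exact: L_cvg.
Qed.

Let lim_PdLV : lim \in @is_PdLV R n d.
Proof. by rewrite inE. Qed.

Lemma PdLV_complete : exists l : E, u @ \oo --> l.
Proof.
exists (MkPdLV lim_PdLV) => U /nbhs_PdLVP[j [e e0 hU]].
have e2 : 0 < e / 2 by rewrite divr_gt0.
have [N hN] := u_cauchy j e2.
exists N => // i /= Ni; apply: hU; rewrite /kball /=.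
(* Bounding a supremum gives only a weak inequality, hence the margin [e / 2]. *)
apply: (@le_lt_trans _ _ (e / 2)); last by lra.
apply: ctb_norm_le.
- exact: compact_cball.
- exact: compact_lipschitz_Conv.
- exact: ltW.
move=> f phi Kf sphi phi1.
apply: (@L_near f phi i); exists N => // k /= Nk.
apply: le_trans (ltW (hN i k Ni Nk)).
exact: (ctb_norm_ub1 (@compact_cball R n _) (@compact_lipschitz_Conv R n _)
  (u i - u k) Kf sphi phi1).
Qed.

End completeness.

(** * The translation-invariant metric *)

Section metric.
Context (R : realType) (n d : nat).
Local Notation E := (PdLV R n d).
Implicit Types (Psi Phi : E).

Let minr_ge0 j Psi : 0 <= Num.min j.+1%:R^-1 (knorm j Psi).
Proof. by rewrite le_min invr_ge0 ler0n knorm_ge0. Qed.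

(** Points are separated because each evaluation is bounded by some [knorm j]. *)
Lemma ctb_dist_eq0 Psi Phi : ctb_dist Psi Phi = 0 <-> Psi = Phi.
Proof.
split=> [d0|->]; last first.
  apply/eqP; rewrite eq_le; apply/andP; split.
    by apply: ctb_dist_le => j; rewrite subrr knorm0 ge_min lexx orbT.
  by apply: le_trans (ctb_dist_ub 0 _ _); exact: minr_ge0.
have k0 j : knorm j (Psi - Phi) = 0.
  apply/eqP; rewrite eq_le knorm_ge0 andbT; apply/ler_addgt0Pr => e e0.
  rewrite add0r ltW// ctb_dist_kball// d0 lt_min e0 andbT.
  by rewrite invr_gt0 ltr0n.
apply: PdLV_ext => f phi; apply/eqP; rewrite -subr_eq0; apply/eqP/eq0_normc.
have [j hj] := PdLV_eval_le d f (@Cc_compact _ _ phi).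
apply/eqP; rewrite eq_le normc_ge0 andbT.
by have := hj (Psi - Phi) phi (@subset_refl _ _); rewrite k0 mul0r.
Qed.

Let ctb_dist_congr Psi Phi (Psi' Phi' : E) :
  (forall j, knorm j (Psi - Phi) = knorm j (Psi' - Phi')) ->
  ctb_dist Psi Phi = ctb_dist Psi' Phi'.
Proof.
by move=> h; rewrite /ctb_dist (funext (fun j => congr1 (Num.min _) (h j))).
Qed.

Lemma ctb_dist_sym Psi Phi : ctb_dist Psi Phi = ctb_dist Phi Psi.
Proof.
by apply: ctb_dist_congr => j; exact: knormBC.
Qed.

Lemma ctb_dist_triangle Psi Phi (Xi : E) :
  ctb_dist Psi Xi <= ctb_dist Psi Phi + ctb_dist Phi Xi.
Proof.
apply: ctb_dist_le => j.
apply: le_trans (lerD (ctb_dist_ub j Psi Phi) (ctb_dist_ub j Phi Xi)).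
have := knorm_triangle j Psi Phi Xi; have := knorm_ge0 j (Psi - Phi).
have := knorm_ge0 j (Phi - Xi).
(* Truncation at a positive level is subadditive on nonnegative reals. *)
have : 0 < j.+1%:R^-1 :> R by rewrite invr_gt0 ltr0n.
move: j.+1%:R^-1 (knorm j (Psi - Phi)) (knorm j (Phi - Xi)) (knorm j (Psi - Xi)).
by move=> a p q s; case: (leP a s); case: (leP a p); case: (leP a q) => *; lra.
Qed.

Lemma ctb_dist_translate Psi Phi (Xi : E) :
  ctb_dist (Psi + Xi) (Phi + Xi) = ctb_dist Psi Phi.
Proof.
by apply: ctb_dist_congr => j; rewrite opprD addrACA subrr addr0.
Qed.

Lemma nbhs_ctb_dist Psi : nbhs Psi = filter_from [set e : R | 0 < e]
  (fun e => [set Phi | ctb_dist Psi Phi < e]).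
Proof.
apply/seteqP; split=> U.
  move=> /nbhs_PdLVP[j [e e0 h]].
  exists (Num.min j.+1%:R^-1 e).
    by rewrite /= lt_min e0 invr_gt0 ltr0n.
  move=> Phi /= hd; apply: h; rewrite /kball /= knormBC.
  exact: ctb_dist_kball hd.
move=> [e /= e0 h].
have e2 : 0 < e / 2 by rewrite divr_gt0.
have [j hj] := kball_ctb_dist n d e2.
apply/nbhs_PdLVP; exists j, (e / 2) => // Phi; rewrite /kball /= => hP.
apply: h => /=; apply: (@le_lt_trans _ _ (e / 2)); last by lra.
by apply: hj; rewrite knormBC.
Qed.

End metric.

Theorem theorem6 (R : realType) (n d : nat) : frechet_space (PdLV R n d).
Proof.
split.
- exact: PdLV_add_continuous.
- exact: PdLV_scale_continuous.
- exact: PdLV_convex_basis.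
exists (@ctb_dist R n d); split; first split.
- exact: ctb_dist_eq0.
- exact: ctb_dist_sym.
- exact: ctb_dist_triangle.
- by move=> x y z; exact: ctb_dist_translate.
- exact: nbhs_ctb_dist.
(* A metric Cauchy sequence is Cauchy for each [knorm j]: below the cap, the truncated norm is the
   norm itself. *)
move=> u cu; apply: PdLV_complete => j e e0.
have [|N hN] := cu (Num.min j.+1%:R^-1 e).
  by rewrite lt_min e0 invr_gt0 ltr0n.
by exists N => a b Na Nb; apply: ctb_dist_kball; exact: hN.
Qed.
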